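(* Let $G$ be a finite simple connected graph which is complete intersection. Then exactly one of the following holds: (1) all blocks of $G$ are bipartite; (2) all blocks of $G$ are bipartite except one; (3) all blocks of $G$ are bipartite except two, and these two blocks are contiguous.
   Context: For a finite simple graph $G$ with edges $e_1,\dots,e_m$ and a field $K$, the toric ideal $I_G\subseteq K[e_1,\dots,e_m]$ is the kernel of the $K$-algebra map $e_i=\{v_j,v_k\}\mapsto v_jv_k$; $G$ is complete intersection if $I_G$ is generated by $\operatorname{ht}(I_G)$ elements. A block of $G$ is a maximal connected subgraph without cut vertex (a maximal biconnected subgraph). Two blocks of $G$ are called contiguous if there is a path from one to the other in which each edge of the path belongs to a different block of $G$. *)

(* Defs.v *)
From HB Require Import structures.
From mathcomp Require Import all_boot all_order all_algebra.
Set Implicit Arguments. Unset Strict Implicit. Unset Printing Implicit Defensive.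
Import GRing.Theory.
Local Open Scope ring_scope.

(* Multivariate polynomial rings R[x_0, ..., x_{n-1}], built as        *)
(* iterated univariate polynomial rings: mpoly R 0 = R,                *)
(* mpoly R n.+1 = {poly mpoly R n}; the outermost 'X is x_0.           *)
Fixpoint mpoly (R : comNzRingType) (n : nat) : comNzRingType :=
  match n with
  | 0 => R
  | n'.+1 => ({poly mpoly R n'} : comNzRingType)
  end.

(* the variable x_i (and 0 if i >= n) *)
Fixpoint mvar (R : comNzRingType) (n i : nat) {struct n} : mpoly R n :=
  match n return mpoly R n with
  | 0 => 0
  | n'.+1 => match i with
             | 0 => ('X : {poly mpoly R n'})
             | i'.+1 => ((mvar R n' i')%:P : {poly mpoly R n'})
             end
  end.

Fixpoint mconst (R : comNzRingType) (n : nat) : R -> mpoly R n :=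
  match n return R -> mpoly R n with
  | 0 => fun c => c
  | n'.+1 => fun c => ((mconst n' c)%:P : {poly mpoly R n'})
  end.

Fixpoint meval (R S : comNzRingType) (f : R -> S) (n : nat) (a : nat -> S)
  {struct n} : mpoly R n -> S :=
  match n return mpoly R n -> S with
  | 0 => f
  | n'.+1 => fun p : {poly mpoly R n'} =>
      \sum_(i < size p) meval f (fun j => a j.+1) p`_i * a 0%N ^+ i
  end.

Definition is_ideal (R : comNzRingType) (I : R -> Prop) : Prop :=
  [/\ I 0, (forall x y, I x -> I y -> I (x + y)) & (forall r x, I x -> I (r * x))].

Definition is_prime_ideal (R : comNzRingType) (P : R -> Prop) : Prop :=
  [/\ is_ideal P, ~ P 1 & (forall x y, P (x * y) -> P x \/ P y)].

Definition generated_by (R : comNzRingType) (I : R -> Prop) (k : nat) : Prop :=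
  exists g : k.-tuple R,
    forall x, I x <-> exists c : k.-tuple R, x = \sum_(i < k) tnth c i * tnth g i.

Definition prime_chain_to (R : comNzRingType) (P : R -> Prop) (k : nat) : Prop :=
  exists Q : nat -> R -> Prop,
    [/\ forall i, (i <= k)%N -> is_prime_ideal (Q i),
        forall i, (i < k)%N -> (forall x, Q i x -> Q i.+1 x) /\
                                (exists x, Q i.+1 x /\ ~ Q i x)
      & forall x, Q k x <-> P x].

(* ht(I) = h : the minimum over the primes P containing I of ht(P) is h,
   where ht(P) is the supremum of lengths of prime chains ending at P. *)
Definition ideal_height (R : comNzRingType) (I : R -> Prop) (h : nat) : Prop :=
  (forall P, is_prime_ideal P -> (forall x, I x -> P x) -> prime_chain_to P h) /\
  (exists P, [/\ is_prime_ideal P, (forall x, I x -> P x) & ~ prime_chain_to P h.+1]).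

(* Finite simple graphs: e : rel T symmetric and irreflexive.          *)
Section Graph.
Variables (T : finType) (e : rel T).

Definition edges : seq (T * T) :=
  [seq xy <- [seq (x, y) | x <- enum T, y <- enum T] |
     e xy.1 xy.2 && (enum_rank xy.1 < enum_rank xy.2)%N].

Definition nedges : nat := size edges.

(* the K-algebra map K[e_1..e_m] -> K[v_1..v_n], e_i = {x,y} |-> v_x v_y,
   where vertex v is the variable with index enum_rank v *)
Definition toric_map (K : fieldType) : mpoly K nedges -> mpoly K #|T| :=
  meval (@mconst K #|T|)
        (fun i => nth 0 [seq mvar K #|T| (enum_rank xy.1) * mvar K #|T| (enum_rank xy.2)
                        | xy <- edges] i).

Definition toric_ideal (K : fieldType) : mpoly K nedges -> Prop :=
  fun p => toric_map (K:=K) p = 0.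

Definition complete_intersection (K : fieldType) : Prop :=
  exists h, ideal_height (@toric_ideal K) h /\ generated_by (@toric_ideal K) h.

End Graph.

(* Blocks of a graph.  Subgraphs are given by their vertex set B (a    *)
(* maximal connected subgraph without cut vertex is necessarily an     *)
(* induced subgraph, so blocks are determined by their vertex sets).   *)
Section Blocks.
Variables (T : finType) (e : rel T).

Definition induced_rel (B : {set T}) : rel T :=
  fun x y => [&& e x y, x \in B & y \in B].

Definition induced_connected (B : {set T}) : bool :=
  (B != set0) && [forall x in B, forall y in B, connect (induced_rel B) x y].

Definition cut_vertex (B : {set T}) (v : T) : bool :=
  (v \in B) &&
  [exists x in B :\ v, exists y in B :\ v, ~~ connect (induced_rel (B :\ v)) x y].

Definition conn_nocut (B : {set T}) : bool :=
  induced_connected B && [forall v, ~~ cut_vertex B v].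

Definition is_block (B : {set T}) : bool :=
  conn_nocut B && [forall B' : {set T}, (B \subset B') && conn_nocut B' ==> (B' == B)].

Definition bipartite_on (B : {set T}) : bool :=
  [exists c : {ffun T -> bool}, forall x in B, forall y in B, e x y ==> (c x != c y)].

Definition edge_in (B : {set T}) (x y : T) : bool := [&& e x y, x \in B & y \in B].

Definition contiguous (B1 B2 : {set T}) : Prop :=
  exists (x : T) (s : seq T),
    [/\ x \in B1, last x s \in B2, path e x s, uniq (x :: s) &
        forall i j, (i < size s)%N -> (j < size s)%N -> i != j ->
          forall B, is_block B ->
            ~~ (edge_in B (nth x (x :: s) i) (nth x (x :: s) i.+1) &&
                edge_in B (nth x (x :: s) j) (nth x (x :: s) j.+1))].

Definition nonbip_blocks : {set {set T}} :=
  [set B : {set T} | is_block B && ~~ bipartite_on B].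
End Blocks.

(* Main.v *)
Require Import Defs.
From HB Require Import structures.
(* Loaded first because mpoly exports a notion [symmetric] that would shadow the one of ssrbool. *)
From mathcomp Require Import ssrcomplements mpoly.
From mathcomp Require Import all_boot all_order all_algebra.
From mathcomp Require Import boolp zify ring.
Set Implicit Arguments. Unset Strict Implicit. Unset Printing Implicit Defensive.
Import Order.TTheory GRing.Theory Num.Theory.
Local Open Scope ring_scope.

(** Let G be connected and non-bipartite with n vertices and m edges, and let L be the
    kernel of the incidence map Z^m -> Z^n.  The variables of n independent edges are
    algebraically independent modulo the toric ideal I, so a chain of primes of length h
    ending at I gives h <= m - n.  If h elements generate I, then so do at most h binomials:
    modulo the products of I with the irrelevant ideal, an irredundant list of binomials is
    independent.  For every vertex set S, the exponent vectors of those binomials that live on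
    S span L_S mod 2, where L_S consists of the vectors of L supported on edges inside S; as L
    contains m - n vectors that are independent mod 2, all the exponent vectors together are
    independent mod 2.  Hence the family L_S mod 2 is distributive: L_S meets L_S1 + L_S2 in
    the sum of the L_(S cap Si).

    A non-bipartite connected set S and c in S carry a vector q with boundary 2c, whose
    coordinates sum to 1, whereas vectors of L have sum 0.  For two such sets S1, S2 attached
    at c1, c2, the class of q1 + q2 mod 2 lies in L of S1, S2 and any connection between c1
    and c2.  By distributivity any two connections share a third one, and c1, c2 are not
    attached to a common non-bipartite set D.  Blocks provide such configurations because
    everything outside a block hangs off it at a single vertex. *)

(** * Ideals *)

Section Ideals.
Variables (R : comNzRingType) (I : R -> Prop).
Hypothesis idealI : is_ideal I.

Lemma idealN x : I x -> I (- x).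
Proof. by case: idealI => _ _ IM Ix; rewrite -mulN1r; apply: IM. Qed.

Lemma ideal_sum (T : Type) (r : seq T) (P : pred T) (F : T -> R) :
  (forall i, P i -> I (F i)) -> I (\sum_(i <- r | P i) F i).
Proof. by case: idealI => I0 ID _ IF; apply: (big_ind I). Qed.

End Ideals.

Definition ideal_span (R : comNzRingType) (G : R -> Prop) (x : R) : Prop :=
  forall I, is_ideal I -> (forall g, G g -> I g) -> I x.

Section IdealSpan.
Variable R : comNzRingType.
Implicit Types (G I : R -> Prop) (x : R).

Lemma ideal_span_ideal G : is_ideal (ideal_span G).
Proof.
split=> [I [I0 _ _] //|x y Gx Gy I idI GI|r x Gx I idI GI]; case: (idI) => I0 ID IM.
- by apply: ID; [apply: Gx | apply: Gy].
- by apply: IM; apply: Gx.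
Qed.

Lemma mem_ideal_span G x : G x -> ideal_span G x.
Proof. by move=> Gx I _; apply. Qed.

Lemma ideal_span_min G I x :
  is_ideal I -> (forall g, G g -> I g) -> ideal_span G x -> I x.
Proof. by move=> idI GI; apply. Qed.

Lemma generator_mem I k (g : k.-tuple R) :
  (forall x, I x <-> exists c : k.-tuple R, x = \sum_(i < k) tnth c i * tnth g i) ->
  forall i, I (tnth g i).
Proof.
move=> Ig i; apply/Ig; exists [tuple (j == i)%:R | j < k].
rewrite (bigD1 i) //= tnth_mktuple eqxx mul1r big1 ?addr0 // => j ji.
by rewrite tnth_mktuple (negbTE ji) mul0r.
Qed.

End IdealSpan.

Section PreimageIdeals.
Variables (R S : comNzRingType) (f : {rmorphism R -> S}).

Lemma preimage_is_prime (P : S -> Prop) : is_prime_ideal P -> is_prime_ideal (P \o f).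
Proof.
case=> [[P0 PD PM] P1 primeP]; split=> [||x y /=]; last by rewrite rmorphM; apply: primeP.
  split=> [|x y|r x] /=; first by rewrite rmorph0.
    by rewrite rmorphD; apply: PD.
  by rewrite rmorphM; apply: PM.
by rewrite /= rmorph1.
Qed.

Lemma rmorph_ker_is_prime (D : idomainType) (h : {rmorphism R -> D}) :
  is_prime_ideal (fun x => h x = 0).
Proof.
split=> [||x y]; last by rewrite rmorphM => /eqP; rewrite mulf_eq0 => /orP[] /eqP ->; auto.
  split=> [|x y x0 y0|r x x0]; first by rewrite rmorph0.
    by rewrite rmorphD x0 y0 addr0.
  by rewrite rmorphM x0 mulr0.
by rewrite rmorph1; apply/eqP/oner_neq0.
Qed.

Variable g : {rmorphism S -> R}.
Hypotheses (fK : cancel f g) (gK : cancel g f).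

Lemma preimage_prime_chain (P : S -> Prop) h :
  prime_chain_to P h -> prime_chain_to (P \o f) h.
Proof.
case=> Q [primeQ chainQ QP]; exists (fun i => Q i \o f); split=> [i ih|i ih|x].
- exact/preimage_is_prime/primeQ.
- have [sQ [x [Qx nQx]]] := chainQ i ih.
  by split=> [y /sQ //|]; exists (g x); rewrite /= gK.
- exact: QP.
Qed.

Lemma preimage_generated_by (I : S -> Prop) h :
  generated_by I h -> generated_by (I \o f) h.
Proof.
case=> G IG; exists (map_tuple g G) => x; rewrite /= IG.
split=> [[c xE]|[c ->]].
  exists (map_tuple g c); rewrite -[x]fK xE rmorph_sum.
  by apply: eq_bigr => i _; rewrite rmorphM !tnth_map.
exists (map_tuple f c); rewrite rmorph_sum.
by apply: eq_bigr => i _; rewrite rmorphM !tnth_map gK.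
Qed.

End PreimageIdeals.

(** * Iterated polynomial rings *)

Section IteratedEvaluation.
Variables (R S : comNzRingType) (f : {rmorphism R -> S}).

Lemma iter_meval_rmorph n (a : nat -> S) :
  exists g : {rmorphism Defs.mpoly R n -> S}, g =1 Defs.meval f a.
Proof.
elim: n a => [|n IHn] a; first by exists f.
have [g gE] := IHn (fun j => a j.+1).
have cga : commr_rmorph g (a 0%N) by move=> x; apply: mulrC.
exists (horner_morph cga) => p /=.
by rewrite /horner_morph /map_poly horner_poly; apply: eq_bigr => i _; rewrite gE.
Qed.

Lemma iter_meval_is_zmod_morphism n (a : nat -> S) :
  zmod_morphism (Defs.meval f (n := n) a).
Proof. by have [g gE] := iter_meval_rmorph n a => x y; rewrite -!gE rmorphB. Qed.

Lemma iter_meval_is_monoid_morphism n (a : nat -> S) :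
  monoid_morphism (Defs.meval f (n := n) a).
Proof.
by have [g gE] := iter_meval_rmorph n a; split=> [|x y]; rewrite -!gE ?rmorph1 ?rmorphM.
Qed.

HB.instance Definition _ n a := GRing.isZmodMorphism.Build
  (Defs.mpoly R n) S (Defs.meval f (n := n) a) (@iter_meval_is_zmod_morphism n a).
HB.instance Definition _ n a := GRing.isMonoidMorphism.Build
  (Defs.mpoly R n) S (Defs.meval f (n := n) a) (@iter_meval_is_monoid_morphism n a).

Lemma iter_mevalC n (a : nat -> S) (c : Defs.mpoly R n) :
  Defs.meval f (n := n.+1) a (c%:P : {poly _}) = Defs.meval f (fun j => a j.+1) c.
Proof.
rewrite /= size_polyC; case: eqVneq => [->|_]; first by rewrite big_ord0 rmorph0.
by rewrite big_ord1 coefC mulr1.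
Qed.

Lemma iter_mevalX n (a : nat -> S) :
  Defs.meval f (n := n.+1) a ('X : {poly _}) = a 0%N.
Proof.
by rewrite /= size_polyX !big_ord_recl big_ord0 !coefX rmorph0 rmorph1
  mul0r mul1r add0r addr0.
Qed.

Lemma iter_meval_var n i (a : nat -> S) : (i < n)%N -> Defs.meval f a (mvar R n i) = a i.
Proof.
elim: n i a => [|n IHn] [|i] a // lt_in; first exact: iter_mevalX.
exact: etrans (iter_mevalC _ _) (IHn _ _ lt_in).
Qed.

Lemma iter_meval_const n (a : nat -> S) c : Defs.meval f a (mconst n c) = f c.
Proof. by elim: n a => [|n IHn] a //; apply: etrans (iter_mevalC _ _) (IHn _). Qed.

End IteratedEvaluation.

Section IteratedPolynomials.
Variable R : comNzRingType.

Lemma mconst_is_zmod_morphism n : zmod_morphism (@mconst R n).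
Proof. by elim: n => [|n IHn] x y //=; rewrite IHn polyCB. Qed.

Lemma mconst_is_monoid_morphism n : monoid_morphism (@mconst R n).
Proof.
by elim: n => [|n [IH1 IHM]] //=; split=> [|x y] /=; rewrite ?IH1 ?IHM ?polyCM.
Qed.

HB.instance Definition _ n := GRing.isZmodMorphism.Build
  R (Defs.mpoly R n) (@mconst R n) (@mconst_is_zmod_morphism n).
HB.instance Definition _ n := GRing.isMonoidMorphism.Build
  R (Defs.mpoly R n) (@mconst R n) (@mconst_is_monoid_morphism n).

Lemma iter_rmorph_ext (S : comNzRingType) n (f g : {rmorphism Defs.mpoly R n -> S}) :
    (forall c, f (mconst n c) = g (mconst n c)) ->
    (forall i, (i < n)%N -> f (mvar R n i) = g (mvar R n i)) -> f =1 g.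
Proof.
elim: n f g => [|n IHn] f g fgC fgX; first exact: fgC.
pose inC : {rmorphism Defs.mpoly R n -> Defs.mpoly R n.+1} := polyC.
have fg0 : f \o inC =1 g \o inC.
  by apply: IHn => [c|i lt_in] /=; [apply: fgC | apply: (fgX i.+1)].
move=> p; elim/(@poly_ind (Defs.mpoly R n)): p => [|p c IHp]; first by rewrite !rmorph0.
rewrite !(rmorphD, rmorphM) IHp; congr (_ * _ + _); first exact: (fgX 0%N).
exact: fg0.
Qed.

Lemma mpoly_rmorph_ext (S : comNzRingType) n (f g : {rmorphism {mpoly R[n]} -> S}) :
  (forall c, f c%:MP = g c%:MP) -> (forall i, f 'X_i = g 'X_i) -> f =1 g.
Proof.
move=> fgC fgX; elim/mpolyind => [|c a p _ _ IHp]; first by rewrite !rmorph0.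
rewrite !rmorphD IHp -mul_mpolyC !rmorphM fgC mpolyXE_id !rmorph_prod.
by congr (_ * _ + _); apply: eq_bigr => i _; rewrite !rmorphXn fgX.
Qed.

Definition mpoly_of_iter n : Defs.mpoly R n -> {mpoly R[n]} :=
  Defs.meval (@mpolyC n R) (fun i => if insub i is Some j then 'X_j else 0).

Definition iter_of_mpoly n : {mpoly R[n]} -> Defs.mpoly R n :=
  mmap (@mconst R n) (fun i => mvar R n i).

HB.instance Definition _ n := GRing.RMorphism.on (@mpoly_of_iter n).
HB.instance Definition _ n := GRing.RMorphism.on (@iter_of_mpoly n).

Lemma mpoly_of_iter_const n c : mpoly_of_iter (mconst n c) = c%:MP.
Proof. exact: iter_meval_const. Qed.

Lemma mpoly_of_iter_var n (i : 'I_n) : mpoly_of_iter (mvar R n i) = 'X_i.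
Proof. by rewrite /mpoly_of_iter iter_meval_var ?valK. Qed.

Lemma iter_of_mpolyC n c : iter_of_mpoly c%:MP = mconst n c.
Proof. exact: mmapC. Qed.

Lemma iter_of_mpolyX n (i : 'I_n) : iter_of_mpoly 'X_i = mvar R n i.
Proof. by rewrite /iter_of_mpoly mmapX mmap1U. Qed.

Lemma mpoly_of_iterK n : cancel (@mpoly_of_iter n) (@iter_of_mpoly n).
Proof.
apply: (iter_rmorph_ext (f := @iter_of_mpoly n \o @mpoly_of_iter n) (g := idfun)) =>
  [c|i lt_in] /=.
  by rewrite mpoly_of_iter_const iter_of_mpolyC.
by rewrite (mpoly_of_iter_var (Ordinal lt_in)) iter_of_mpolyX.
Qed.

Lemma iter_of_mpolyK n : cancel (@iter_of_mpoly n) (@mpoly_of_iter n).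
Proof.
apply: (mpoly_rmorph_ext (f := @mpoly_of_iter n \o @iter_of_mpoly n) (g := idfun)) => [c|i] /=.
  by rewrite iter_of_mpolyC mpoly_of_iter_const.
by rewrite iter_of_mpolyX mpoly_of_iter_var.
Qed.

End IteratedPolynomials.

(** * Algebraic independence and chains of primes *)

Lemma mmap_muni (R S : comNzRingType) (f : {rmorphism R -> S}) n (h : 'I_n.+1 -> S) p :
  mmap f h p =
    (map_poly (mmap f (fun i => h (widen_ord (leqnSn n) i))) (muni p)).[h ord_max].
Proof.
pose hn i := h (widen_ord (leqnSn n) i).
pose g : {rmorphism {poly {mpoly R[n]}} -> S} :=
  horner_morph (fun x : {mpoly R[n]} => mulrC (h ord_max) (mmap f hn x)).
apply: (mpoly_rmorph_ext (f := mmap f h) (g := g \o @muni n R)) => [c|i].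
  by rewrite /= muniC /horner_morph map_polyC hornerC /= !mmapC.
rewrite /= /muni !mmapX !mmap1U /horner_morph; case: splitP => [j ij|j ij].
  rewrite map_polyC hornerC /= mmapX mmap1U; congr h; exact: val_inj.
rewrite map_polyX hornerX; congr h; apply: val_inj.
by move: ij; rewrite ord1 addn0.
Qed.

Lemma muni_inj (R : comNzRingType) n : injective (@muni n R).
Proof.
apply: (can_inj (g := fun q =>
  (map_poly (mmap (@mpolyC _ R) (fun i => 'X_(widen_ord (leqnSn n) i))) q).['X_ord_max])).
move=> p; rewrite -(mmap_muni (@mpolyC n.+1 R) (fun i => 'X_i)) [RHS]mpolyE.
by apply: eq_bigr => a _; rewrite mmap1_id mul_mpolyC.
Qed.

Lemma mpoly_linear_dependence (K : fieldType) m (J : seq 'X_{1..m}) (X : finType)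
    (v : X -> {mpoly K[m]}) :
  (forall x, {subset msupp (v x) <= J}) -> (size J < #|X|)%N ->
  exists2 c : X -> K, exists x, c x != 0 & \sum_x c x *: v x = 0.
Proof.
move=> vJ ltJX.
pose A : 'M[K]_(#|X|, size J) := \matrix_(i, j) (v (enum_val i))@_(tnth (in_tuple J) j).
have kerA : kermx A != 0.
  by rewrite kermx_eq0 -row_leq_rank -ltnNge (leq_ltn_trans (rank_leq_col _)).
pose c x : K := nz_row (kermx A) 0 (enum_rank x); exists c.
  have : nz_row (kermx A) != 0 by rewrite nz_row_eq0.
  by case/rV0Pn=> i ci; exists (enum_val i); rewrite /c enum_valK.
apply/mpolyP => a; rewrite mcoeff0 (raddf_sum (mcoeff a)) /=.
have [/(tnthP (in_tuple J))[j ->]|nJa] := boolP (a \in J); last first.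
  rewrite big1 // => x _; rewrite mcoeffZ memN_msupp_eq0 ?mulr0 //.
  exact: contra (vJ x a) nJa.
have /eqP/rowP/(_ j) : nz_row (kermx A) *m A == 0 by rewrite -sub_kermx nz_row_sub.
rewrite mxE [RHS]mxE => kerE; rewrite -[RHS]kerE.
rewrite (reindex_onto enum_val enum_rank) => [|x _] /=; last exact: enum_rankK.
apply: eq_big => [i|i _]; first by rewrite enum_valK eqxx.
by rewrite mcoeffZ mxE /c enum_valK.
Qed.

Section AlgebraicIndependence.
Variables (K A : comNzRingType) (f : {rmorphism K -> A}).

Definition alg_indep_mod (P : A -> Prop) k (y : 'I_k -> A) : Prop :=
  forall F : {mpoly K[k]}, P (mmap f y F) -> F = 0.

Lemma alg_indep_mod_extend (P Q : A -> Prop) k (y : 'I_k -> A) :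
    is_prime_ideal P -> is_ideal Q -> (forall x, P x -> Q x) -> (exists x, Q x /\ ~ P x) ->
    alg_indep_mod Q y -> exists z : 'I_k.+1 -> A, alg_indep_mod P z.
Proof.
move=> [_ _ primeP] [_ QD QM] PQ [x [Qx nPx]] indy.
pose z (i : 'I_k.+1) := oapp y x (insub (val i)); exists z => F.
rewrite mmap_muni {2}/z insubN ?ltnn //=.
have -> : (fun i => z (widen_ord (leqnSn k) i)) = y by apply/funext => i; rewrite /z /= valK.
move=> PF; apply: muni_inj; rewrite raddf0; move: (muni F) PF.
elim/poly_ind => [//|G c IHG]; rewrite rmorphD rmorphM /= map_polyX map_polyC !hornerE => PG.
have c0 : c = 0.
  apply: indy; rewrite -[mmap f y c](addKr ((map_poly (mmap f y) G).[x] * x)).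
  by apply: QD; [rewrite -mulNr; apply: QM | apply: PQ].
move: PG; rewrite c0 raddf0 addr0 polyC0 addr0 => /primeP[|//].
by move/IHG => ->; rewrite mul0r.
Qed.

Lemma prime_chain_alg_indep (P : A -> Prop) h k (y : 'I_k -> A) :
  prime_chain_to P h -> alg_indep_mod P y ->
  exists z : 'I_(h + k) -> A, alg_indep_mod (fun x => x = 0) z.
Proof.
case=> Q [primeQ chainQ QP] indP.
suff chain_indep i : (i <= h)%N -> exists z : 'I_(i + k) -> A, alg_indep_mod (Q (h - i)%N) z.
  have [z] := chain_indep h (leqnn h); rewrite subnn => indz; exists z => F F0.
  by apply: indz; rewrite F0; have [[]] := primeQ 0%N isT.
elim: i => [|i IHi] lt_ih; first by exists y; rewrite subn0 => F /QP; apply: indP.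
have [z indz] := IHi (ltnW lt_ih).
have [|sQ exQ] := chainQ (h - i.+1)%N; first by rewrite subnSK // leq_subr.
rewrite subnSK // in sQ exQ.
apply: alg_indep_mod_extend sQ exQ indz; first by apply: primeQ; rewrite leq_subr.
by have [] := primeQ (h - i)%N (leq_subr _ _).
Qed.

End AlgebraicIndependence.

Lemma mnm_leq_mdeg n (a : 'X_{1..n}) i : (a i <= mdeg a)%N.
Proof. by rewrite mdegE (bigD1 i) //= leq_addr. Qed.

Section DegreeBound.
Variables (K : idomainType) (n : nat).

Lemma msizeM_bound (p q : {mpoly K[n]}) b c :
  (msize p <= b.+1)%N -> (msize q <= c.+1)%N -> (msize (p * q) <= (b + c).+1)%N.
Proof.
have [->|p0] := eqVneq p 0; first by rewrite mul0r msize0.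
have [->|q0] := eqVneq q 0; first by rewrite mulr0 msize0.
by rewrite msizeM // => pb qc; rewrite -subn1 leq_subLR add1n -addSn -addnS leq_add.
Qed.

Lemma msize_mmap1 k (y : 'I_k -> {mpoly K[n]}) D (a : 'X_{1..k}) :
  (forall i, msize (y i) <= D.+1)%N -> (msize (mmap1 y a) <= (D * mdeg a).+1)%N.
Proof.
move=> yD; rewrite mdegE big_distrr /=.
apply: (big_ind2 (fun (p : {mpoly K[n]}) b => msize p <= b.+1)%N) => [|p b q c|i _].
- by rewrite msize1.
- exact: msizeM_bound.
elim: (a i) => [|j IHj]; first by rewrite expr0 msize1.
by rewrite exprS mulnS; apply: msizeM_bound.
Qed.

End DegreeBound.

(* A counting argument: the N^k monomials with exponents below N in elements of degree at
   most D of K[x_1..x_m] are polynomials with exponents below (D * k + 1) * N, and there are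
   only ((D * k + 1) * N)^m such monomials. *)
Lemma alg_indep_leq (K : fieldType) m k (y : 'I_k -> {mpoly K[m]}) :
  alg_indep_mod (@mpolyC m K) (fun x => x = 0) y -> (k <= m)%N.
Proof.
move=> indy; rewrite leqNgt; apply/negP => lt_mk.
pose D := (\max_i msize (y i))%N; pose b := (D * k).+1.
pose N := (b ^ m).+1; pose M := (b * N)%N.
have yD i : (msize (y i) <= D.+1)%N by apply: leqW; apply: (leq_bigmax i).
pose expo (x : {ffun 'I_k -> 'I_N}) := [multinom (x i : nat) | i < k].
pose J := [seq [multinom (x i : nat) | i < m] | x : {ffun 'I_m -> 'I_M}].
have expo_lt x : (D * mdeg (expo x) < M)%N.
  have : (mdeg (expo x) <= k * N.-1)%N.
    rewrite mdegE -[k in (k * _)%N]card_ord -sum_nat_const; apply: leq_sum => i _.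
    by rewrite mnmE -ltnS ltn_ord.
  by move/(leq_mul (leqnn D)); rewrite /M /b /N /=; nia.
have suppJ x : {subset msupp (mmap1 y (expo x)) <= J}.
  move=> a /msize_mdeg_lt lt_a; have le_a := leq_trans lt_a (msize_mmap1 (expo x) yD).
  have aM i : (a i < M)%N.
    apply: leq_ltn_trans (mnm_leq_mdeg a i) (leq_ltn_trans _ (expo_lt x)).
    by rewrite -ltnS.
  apply/imageP; exists [ffun i => Ordinal (aM i)] => //.
  by apply/mnmP => i; rewrite mnmE ffunE.
have [|c [x cx0] c_rel] := mpoly_linear_dependence suppJ.
  rewrite size_map -cardE !card_ffun !card_ord expnMn.
  apply: leq_trans (leq_pexp2l _ lt_mk) => //.
  by rewrite expnS ltn_pmul2r ?expn_gt0.
have expo_inj : injective expo.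
  move=> x1 x2 /mnmP eqx; apply/ffunP => i; apply: val_inj.
  by have := eqx i; rewrite !mnmE.
have F0 : \sum_x c x *: 'X_[expo x] = 0 :> {mpoly K[k]}.
  apply: indy; rewrite rmorph_sum -[RHS]c_rel; apply: eq_bigr => x' _ /=.
  by rewrite mmapZ mmapX mul_mpolyC.
case/eqP: cx0; have := congr1 (mcoeff (expo x)) F0.
rewrite mcoeff0 raddf_sum (bigD1 x) //= mcoeffZ mcoeffX eqxx mulr1 big1 ?addr0 // => x' neq_x.
by rewrite mcoeffZ mcoeffX (inj_eq expo_inj) (negbTE neq_x) mulr0.
Qed.

Theorem prime_chain_leq (K : fieldType) m (P : {mpoly K[m]} -> Prop) h k
    (y : 'I_k -> {mpoly K[m]}) :
  prime_chain_to P h -> alg_indep_mod (@mpolyC m K) P y -> (h + k <= m)%N.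
Proof. by move=> chainP /(prime_chain_alg_indep chainP)[z /alg_indep_leq]. Qed.

(** * Toric ideals of monomial maps *)

Section LinearExtension.
Variables (R : comNzRingType) (n : nat) (V : lmodType R) (phi : 'X_{1..n} -> V).
Implicit Types p q : {mpoly R[n]}.

Definition mlift p : V := \sum_(a <- msupp p) p@_a *: phi a.

Lemma mlift_bounded p k : (msize p <= k)%N ->
  mlift p = \sum_(a : 'X_{1..n < k}) p@_a *: phi a.
Proof.
move=> le_pk; rewrite /mlift (big_mksub 'X_{1..n < k}) ?msupp_uniq //=; last first.
  by move=> a /msize_mdeg_lt /leq_trans; apply.
by rewrite big_rmcond //= => a /memN_msupp_eq0 ->; rewrite scale0r.
Qed.

Lemma mlift_is_linear : linear mlift.
Proof.
move=> c p q; pose k := maxn (msize (c *: p + q)) (maxn (msize p) (msize q)).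
rewrite !(@mlift_bounded _ k) ?leq_max ?leqnn ?orbT // scaler_sumr -big_split.
by apply: eq_bigr => a _; rewrite mcoeffD mcoeffZ scalerDl scalerA.
Qed.

HB.instance Definition _ := GRing.isLinear.Build R {mpoly R[n]} V *:%R mlift mlift_is_linear.

Lemma mliftX a : mlift 'X_[a] = phi a.
Proof. by rewrite /mlift msuppX big_seq1 mcoeffX eqxx scale1r. Qed.

End LinearExtension.

Section ExponentVectors.
Variables (R : nzRingType) (n : nat).

Definition mnm_row (a : 'X_{1..n}) : 'rV[R]_n := \row_i (a i)%:R.

Lemma mnm_rowD a b : mnm_row (a + b)%MM = mnm_row a + mnm_row b.
Proof. by apply/rowP => i; rewrite !mxE mnmDE natrD. Qed.

End ExponentVectors.

Lemma mnm_row_inj (R : numDomainType) n : injective (@mnm_row R n).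
Proof.
move=> a b /rowP eqab; apply/mnmP => i; apply/eqP; rewrite -(eqr_nat R).
by have := eqab i; rewrite !mxE => ->.
Qed.

Definition binomial (K : comNzRingType) m (u : 'X_{1..m} * 'X_{1..m}) : {mpoly K[m]} :=
  'X_[u.1] - 'X_[u.2].

Definition binomial_span (K : comNzRingType) m (U : seq ('X_{1..m} * 'X_{1..m})) :
    {mpoly K[m]} -> Prop :=
  ideal_span (fun p => exists2 u, u \in U & p = binomial K u).

Section BinomialIdeals.
Variables (K : comNzRingType) (m : nat).
Implicit Types (U V : seq ('X_{1..m} * 'X_{1..m})) (a b c : 'X_{1..m}) (p : {mpoly K[m]}).

Lemma binomial_span_ideal U : is_ideal (binomial_span (K := K) U).
Proof. exact: ideal_span_ideal. Qed.

Lemma mem_binomial_span U u : u \in U -> binomial_span U (binomial K u).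
Proof. by move=> Uu; apply: mem_ideal_span; exists u. Qed.

Lemma binomial_span_min U (I : {mpoly K[m]} -> Prop) p :
  is_ideal I -> (forall u, u \in U -> I (binomial K u)) -> binomial_span U p -> I p.
Proof. by move=> idI UI; apply: ideal_span_min => // _ [u Uu ->]; apply: UI. Qed.

Lemma binomial_span_trans U V p :
  (forall u, u \in U -> binomial_span V (binomial K u)) -> binomial_span U p ->
  binomial_span V p.
Proof. by apply: binomial_span_min; apply: binomial_span_ideal. Qed.

Lemma binomial_spanS U V p : {subset U <= V} -> binomial_span U p -> binomial_span V p.
Proof. by move=> sUV; apply: binomial_span_trans => u /sUV; apply: mem_binomial_span. Qed.

Definition class_sum (phi : pred 'X_{1..m}) : {mpoly K[m]} -> K^o :=
  mlift (fun a => (phi a)%:R : K^o).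

HB.instance Definition _ phi := GRing.Linear.on (class_sum phi).

Lemma class_sum_binomial phi u : class_sum phi (binomial K u) = (phi u.1)%:R - (phi u.2)%:R.
Proof. by rewrite /class_sum raddfB /= !mliftX. Qed.

Lemma class_sum_mulX phi a u :
  class_sum phi ('X_[a] * binomial K u) = (phi (a + u.1)%MM)%:R - (phi (a + u.2)%MM)%:R.
Proof. by rewrite mulrBr -!mpolyXD -[_ - _]/(binomial K (_, _)) class_sum_binomial. Qed.

Definition relation_invariant U (phi : pred 'X_{1..m}) : Prop :=
  forall u, u \in U -> forall a, phi (a + u.1)%MM = phi (a + u.2)%MM.

Lemma relation_invariant_span U phi a b :
  relation_invariant U phi -> binomial_span U (binomial K (a, b)) -> phi a = phi b.
Proof.
move=> Uphi span_ab.
suff /(_ 1) : forall q, class_sum phi (q * binomial K (a, b)) = 0.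
  rewrite mul1r class_sum_binomial /=; case: (phi a) (phi b) => -[] //= /eqP.
    by rewrite subr0 oner_eq0.
  by rewrite sub0r oppr_eq0 oner_eq0.
apply: (binomial_span_min (I := fun p => forall q, class_sum phi (q * p) = 0)) span_ab.
  split=> [q|x y x0 y0 q|r x x0 q]; first by rewrite mulr0 linear0.
    by rewrite mulrDr linearD /= x0 y0 addr0.
  by rewrite mulrA.
move=> u Uu; elim/mpolyind => [|c d q _ _ IHq]; first by rewrite mul0r linear0.
by rewrite mulrDl -scalerAl linearP /= IHq class_sum_mulX Uphi // subrr scaler0 addr0.
Qed.

Definition binomial_class V c : pred 'X_{1..m} :=
  fun a => `[< binomial_span V (binomial K (a, c)) >].

Lemma binomial_class_invariant V c : relation_invariant V (binomial_class V c).
Proof.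
move=> v Vv a; have [_ spanD spanM] := binomial_span_ideal V.
have span_av : binomial_span V (binomial K (a + v.1, a + v.2)%MM).
  by rewrite /binomial !mpolyXD -mulrBr; apply: spanM; apply: mem_binomial_span.
have span_va : binomial_span V (binomial K (a + v.2, a + v.1)%MM).
  by rewrite /binomial -opprB; apply: (idealN (binomial_span_ideal V)) span_av.
have binom_trans b b' : binomial K (b, c) = binomial K (b, b') + binomial K (b', c).
  by rewrite /binomial addrA subrK.
apply/asboolP/asboolP => span_c.
  by rewrite (binom_trans _ (a + v.1)%MM); apply: spanD.
by rewrite (binom_trans _ (a + v.2)%MM); apply: spanD.
Qed.

Lemma binomial_class_refl V c : binomial_class V c c.
Proof. by apply/asboolP; rewrite /binomial subrr => I []. Qed.

End BinomialIdeals.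

Section MonomialMap.
Variables (K : fieldType) (m n : nat) (d : 'I_m -> 'X_{1..n}).
Implicit Types (a b : 'X_{1..m}) (p q : {mpoly K[m]}) (u v : 'X_{1..m} * 'X_{1..m}).

Definition multideg a : 'X_{1..n} := (\sum_i d i *+ a i)%MM.

Definition monomial_map : {mpoly K[m]} -> {mpoly K[n]} :=
  mmap (@mpolyC n K) (fun i => 'X_[d i]).

HB.instance Definition _ := GRing.RMorphism.on monomial_map.

Definition toric_kernel p : Prop := monomial_map p = 0.

Lemma multidegD a b : multideg (a + b)%MM = (multideg a + multideg b)%MM.
Proof.
apply/mnmP => j; rewrite mnmDE !mnm_sumE -big_split; apply: eq_bigr => i _ /=.
by rewrite !mulmnE mnmDE mulnDr.
Qed.

Lemma monomial_mapX a : monomial_map 'X_[a] = 'X_[multideg a].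
Proof. by rewrite /monomial_map mmapX /mmap1 mprodXnE. Qed.

Lemma monomial_mapZ c p : monomial_map (c *: p) = c *: monomial_map p.
Proof. by rewrite -!mul_mpolyC rmorphM /= /monomial_map mmapC. Qed.

Lemma toric_kernel_prime : is_prime_ideal toric_kernel.
Proof. exact: rmorph_ker_is_prime. Qed.

Lemma toric_kernel_ideal : is_ideal toric_kernel.
Proof. by case: toric_kernel_prime. Qed.

Lemma toric_kernel_binomial u :
  toric_kernel (binomial K u) <-> multideg u.1 = multideg u.2.
Proof.
rewrite /toric_kernel rmorphB /= !monomial_mapX; split=> [/eqP|->]; last exact: subrr.
rewrite subr_eq0 => /eqP/(congr1 (mcoeff (multideg u.1))); rewrite !mcoeffX eqxx.
by case: eqP => // _ /eqP; rewrite oner_eq0.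
Qed.

Lemma mlift_monomial_map (V : lmodType K) (phi : 'X_{1..n} -> V) p :
  mlift phi (monomial_map p) = mlift (phi \o multideg) p.
Proof.
elim/mpolyind: p => [|c a p _ _ IHp]; first by rewrite rmorph0 !linear0.
by rewrite rmorphD /= monomial_mapZ monomial_mapX !linearP /= !mliftX IHp.
Qed.

Definition relations (U : seq ('X_{1..m} * 'X_{1..m})) : Prop :=
  forall u, u \in U -> multideg u.1 = multideg u.2.

Definition binomial_generators (U : seq ('X_{1..m} * 'X_{1..m})) : Prop :=
  relations U /\ forall p, toric_kernel p -> binomial_span U p.

Lemma binomial_span_toric U p : relations U -> binomial_span U p -> toric_kernel p.
Proof.
move=> relU; apply: binomial_span_min toric_kernel_ideal _ => u /relU.
by move/toric_kernel_binomial.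
Qed.

(* Replacing each monomial of p by one fixed monomial of the same multidegree turns p into
   0, as the result only depends on the image of p. *)
Lemma toric_kernel_binomial_span p : toric_kernel p ->
  exists U, relations U /\ binomial_span U p.
Proof.
move=> p0; pose rep c := nth 0%MM (msupp p) (find (fun a => multideg a == c) (msupp p)).
pose U := [seq u <- [seq (a, b) | a <- msupp p, b <- msupp p] | multideg u.1 == multideg u.2].
exists U; split=> [u|]; first by rewrite mem_filter => /andP[/eqP].
have rep0 : \sum_(a <- msupp p) p@_a *: 'X_[K, rep (multideg a)] = 0.
  by have := mlift_monomial_map (fun c => 'X_[rep c] : {mpoly K[m]}) p; rewrite p0 linear0.
rewrite -[p]subr0 -rep0 {1}[p]mpolyE -sumrB big_seq.
apply: (ideal_sum (binomial_span_ideal K U)) => a pa.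
rewrite -scalerBr -mul_mpolyC; have [_ _ spanM] := binomial_span_ideal K U.
have has_a : has (fun b => multideg b == multideg a) (msupp p) by apply/hasP; exists a.
apply: spanM; rewrite -[_ - _]/(binomial K (a, rep (multideg a))).
apply: mem_binomial_span; rewrite mem_filter /=.
by rewrite eq_sym (nth_find 0%MM has_a) allpairs_f // mem_nth // -has_find.
Qed.

Lemma binomial_generators_exist h : generated_by toric_kernel h ->
  exists U, binomial_generators U.
Proof.
case=> g gE; have [U UE] := choice (fun i => toric_kernel_binomial_span (generator_mem gE i)).
pose W := flatten [seq U i | i <- enum 'I_h]; exists W.
split=> [u /flatten_mapP[i _ Uu]|p /gE[c ->]].
  by have [rel_i _] := UE i; apply: rel_i.
apply: (ideal_sum (binomial_span_ideal K W)) => i _; have [_ span_i] := UE i.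
have [_ _ spanM] := binomial_span_ideal K W.
apply: spanM; apply: binomial_spanS span_i => u Uu.
by apply/flatten_mapP; exists i; rewrite ?mem_enum.
Qed.

Definition irredundant (U : seq ('X_{1..m} * 'X_{1..m})) : Prop :=
  uniq U /\ forall u, u \in U -> ~ binomial_span (rem u U) (binomial K u).

Lemma irredundant_generators_exist U : binomial_generators U ->
  exists2 V, binomial_generators V & irredundant V.
Proof.
suff shrink k V : (size V <= k)%N -> uniq V -> binomial_generators V ->
    exists2 W, binomial_generators W & irredundant W.
  case=> relU genU; apply: (shrink (size U) (undup U)) (size_undup U) (undup_uniq U) _.
  split=> [u|p /genU]; first by rewrite mem_undup; apply: relU.
  by apply: binomial_spanS => u; rewrite mem_undup.
elim: k V => [|k IHk] V leVk uniqV genV.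
  by exists V => //; move: leVk; rewrite leqn0 => /nilP ->.
have [irrV|] := pselect (irredundant V); first by exists V.
move=> /not_andP[|/existsNP[u /not_implyP[Vu /contrapT redu]]]; first by rewrite uniqV.
apply: (IHk (rem u V)); rewrite ?rem_uniq ?size_rem //.
  by move: leVk; case: (size V).
have [relV spanV] := genV; split=> [v /mem_rem|p /spanV]; first exact: relV.
apply: binomial_span_trans => v Vv; have [-> //|neq_v] := eqVneq v u.
by apply: mem_binomial_span; rewrite mem_rem_uniq // !inE neq_v.
Qed.

Section Homogeneous.
Variable r : nat.
Hypotheses (r_gt0 : (0 < r)%N) (mdeg_d : forall i, mdeg (d i) = r).

Lemma mdeg_multideg a : mdeg (multideg a) = (r * mdeg a)%N.
Proof.
rewrite mdeg_sum mdegE big_distrr; apply: eq_bigr => i _ /=.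
by rewrite mdegMn mdeg_d.
Qed.

Lemma multideg_mdeg a b : multideg a = multideg b -> mdeg a = mdeg b.
Proof. by move/(congr1 (@mdeg n))/eqP; rewrite !mdeg_multideg eqn_pmul2l // => /eqP. Qed.

(* Modulo the other generators, a multiple of [binomial u] by a polynomial without constant
   term lies in larger degrees than the class of [u.1]. *)
Lemma class_sum_mul U u p q : binomial_generators U -> uniq U -> u \in U -> toric_kernel q ->
  class_sum (binomial_class K (rem u U) u.1) (p * q) =
    p@_0%MM * class_sum (binomial_class K (rem u U) u.1) q.
Proof.
move=> [relU genU] uniqU Uu /genU span_q; set phi := binomial_class _ _ _.
have phi_mdeg a : phi a -> mdeg a = mdeg u.1.
  move/asboolP/(binomial_span_toric (U := rem u U)) => rel_a.
  by apply/multideg_mdeg/(toric_kernel_binomial (a, u.1))/rel_a => v /mem_rem; apply: relU.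
apply: (binomial_span_min (I := fun q => forall p,
  class_sum phi (p * q) = p@_0%MM * class_sum phi q)) span_q p.
  split=> [p|x y x0 y0 p|s x x0 p]; first by rewrite mulr0 linear0 mulr0.
    by rewrite mulrDr !linearD /= x0 y0 mulrDr.
  by rewrite mulrA !x0 rmorphM mulrA.
move=> v Uv; elim/mpolyind => [|c a p _ _ IHp]; first by rewrite mul0r linear0 mcoeff0 mul0r.
rewrite mulrDl -scalerAl linearP /= IHp mcoeffD mcoeffZ mulrDl; congr (_ + _).
rewrite mcoeffX -mulrA; congr (_ * _); rewrite class_sum_mulX class_sum_binomial.
have [->|a_neq0] := eqVneq a 0%MM; first by rewrite !add0m mul1r.
rewrite mul0r; have [->|neq_v] := eqVneq v u; last first.
  have Vv : v \in rem u U by rewrite mem_rem_uniq // !inE neq_v.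
  by rewrite /phi binomial_class_invariant // subrr.
have phiF b : mdeg b = mdeg u.1 -> phi (a + b)%MM = false.
  move=> deg_b; apply/negP => /phi_mdeg/eqP.
  by rewrite mdegD deg_b -{2}[mdeg u.1]add0n eqn_add2r mdeg_eq0 (negbTE a_neq0).
by rewrite !phiF ?subrr //; apply/esym/multideg_mdeg/relU.
Qed.

Lemma class_sum_irredundant U u v : irredundant U -> u \in U -> v \in U ->
  class_sum (binomial_class K (rem u U) u.1) (binomial K v) = (u == v)%:R.
Proof.
move=> [uniqU irrU] Uu Uv; rewrite class_sum_binomial.
have [<-|neq_uv] := eqVneq u v; last first.
  have Vv : v \in rem u U by rewrite mem_rem_uniq // !inE eq_sym neq_uv.
  have := binomial_class_invariant K u.1 Vv 0%MM; rewrite !add0m => ->.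
  exact: subrr.
rewrite binomial_class_refl /binomial_class asboolF ?subr0 // => span_u.
apply: (irrU u Uu); rewrite -[binomial K u]opprK /binomial opprB.
exact: (idealN (binomial_span_ideal K _)).
Qed.

(* The functionals attached to the elements of U are dual to U, and by [class_sum_mul] they
   only see the constant terms of the coefficients over a given generating family. *)
Lemma irredundant_size_leq h U : generated_by toric_kernel h ->
  binomial_generators U -> irredundant U -> (size U <= h)%N.
Proof.
case=> g gE genU irrU; pose k := size U; pose u (i : 'I_k) := tnth (in_tuple U) i.
have Uu i : u i \in U by apply: mem_tnth.
have [|c cE] := choice (P := fun i (c : h.-tuple {mpoly K[m]}) =>
    binomial K (u i) = \sum_j tnth c j * tnth g j).
  by move=> i; apply/gE/toric_kernel_binomial; case: genU => relU _; apply: relU.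
pose phi i := binomial_class K (rem (u i) U) (u i).1.
pose C : 'M[K]_(k, h) := \matrix_(i, j) (tnth (c i) j)@_0%MM.
pose L : 'M[K]_(h, k) := \matrix_(j, i) class_sum (phi i) (tnth g j).
suff CL1 : C *m L = 1%:M by rewrite -/k -(mxrank1 K k) -CL1; apply: mulmx_max_rank.
apply/matrixP => i l; rewrite !mxE.
transitivity (class_sum (phi l) (binomial K (u i))).
  rewrite cE linear_sum; apply: eq_bigr => j _; rewrite !mxE /=.
  by rewrite class_sum_mul //; [case: irrU | apply: generator_mem gE j].
rewrite class_sum_irredundant // eq_sym; congr (_ %:R); congr nat_of_bool.
by rewrite /u !(tnth_nth (u i)) nth_uniq //; case: irrU.
Qed.

Lemma binomial_generators_leq h : generated_by toric_kernel h ->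
  exists2 U, binomial_generators U & (size U <= h)%N.
Proof.
move=> gen_h; have [U genU] := binomial_generators_exist gen_h.
have [V genV irrV] := irredundant_generators_exist genU.
by exists V => //; apply: irredundant_size_leq.
Qed.

End Homogeneous.

Definition exponent_mx (R : nzRingType) : 'M[R]_(m, n) := \matrix_(i, j) (d i j)%:R.

Lemma mnm_row_multideg (R : nzRingType) a :
  mnm_row R (multideg a) = mnm_row R a *m exponent_mx R.
Proof.
apply/rowP => j; rewrite !mxE mnm_sumE natr_sum.
by apply: eq_bigr => i _; rewrite !mxE mulmnE mulnC natrM.
Qed.

Lemma monomial_map_eq0 p : injective multideg -> monomial_map p = 0 -> p = 0.
Proof.
move=> inj_deg p0; apply/mpolyP => a; rewrite mcoeff0.
have := mlift_monomial_map (fun c => (c == multideg a)%:R : K^o) p; rewrite p0 linear0 => p_a.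
rewrite {1}[p]mpolyE (raddf_sum (mcoeff a)) [RHS]p_a; apply: eq_bigr => b _.
by rewrite /= mcoeffZ mcoeffX (inj_eq inj_deg).
Qed.

End MonomialMap.

(* The variables x_i for linearly independent rows i are algebraically independent modulo
   the toric ideal. *)
Lemma toric_chain_leq (K : fieldType) m n (d : 'I_m -> 'X_{1..n}) h :
  prime_chain_to (toric_kernel (K := K) d) h ->
  (h + \rank (exponent_mx d rat) <= m)%N.
Proof.
pose f := maxrankfun (exponent_mx d rat); pose df := d \o f.
have inj_deg : injective (multideg df).
  have free_df : row_free (exponent_mx df rat).
    have -> : exponent_mx df rat = rowsub f (exponent_mx d rat).
      by apply/matrixP => i j; rewrite !mxE.
    exact: maxrowsub_free.
  move=> a b /(congr1 (@mnm_row rat n)); rewrite !mnm_row_multideg.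
  by move/(row_free_inj free_df)/mnm_row_inj.
move/(prime_chain_leq (y := fun j => 'X_(f j))); apply=> F F0.
apply: (monomial_map_eq0 inj_deg); rewrite -[RHS]F0.
apply: (mpoly_rmorph_ext (f := monomial_map df)
  (g := monomial_map d \o mmap (@mpolyC m K) (fun j => 'X_(f j)))) => [c|j] /=.
  by rewrite /monomial_map !mmapC.
by rewrite /monomial_map !mmapX !mmap1U mmapX mmap1U.
Qed.

(** * The lattice of a toric complete intersection *)

Definition supported (R : nmodType) m (E : {set 'I_m}) : {pred 'rV[R]_m} :=
  fun w => [forall i, (w 0 i != 0) ==> (i \in E)].

Lemma supportedP (R : nmodType) m (E : {set 'I_m}) (w : 'rV[R]_m) :
  reflect (forall i, w 0 i != 0 -> i \in E) (w \in supported E).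
Proof. by apply: (iffP forallP) => wE i; [apply/implyP | apply/implyP/wE]. Qed.

Lemma supported_eq0 (R : nmodType) m (E : {set 'I_m}) (w : 'rV[R]_m) i :
  w \in supported E -> i \notin E -> w 0 i = 0.
Proof. by move=> /supportedP wE; apply: contraNeq; apply: wE. Qed.

Lemma supportedS (R : nmodType) m (E E' : {set 'I_m}) (w : 'rV[R]_m) :
  E \subset E' -> w \in supported E -> w \in supported E'.
Proof. by move=> /subsetP sE /supportedP wE; apply/supportedP => i /wE/sE. Qed.

Lemma supportedI (R : nmodType) m (E E' : {set 'I_m}) (w : 'rV[R]_m) :
  w \in supported E -> w \in supported E' -> w \in supported (E :&: E').
Proof.
by move=> /supportedP wE /supportedP wE'; apply/supportedP => i wi; rewrite inE wE // wE'.
Qed.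

Lemma supported_zmod_closed (R : zmodType) m (E : {set 'I_m}) : zmod_closed (@supported R m E).
Proof.
split=> [|w w' wE wE']; first by apply/supportedP => i; rewrite mxE eqxx.
apply/supportedP => i; apply: contraR => nEi.
by rewrite !mxE !(supported_eq0 _ nEi) // subr0.
Qed.

HB.instance Definition _ (R : zmodType) m (E : {set 'I_m}) :=
  GRing.isZmodClosed.Build 'rV[R]_m (@supported R m E) (@supported_zmod_closed R m E).

Section IntegerLattice.
Variables (m n : nat) (M : 'M[int]_(m, n)).
Implicit Types (E : {set 'I_m}) (w : 'rV[int]_m).

Definition lattice E : {pred 'rV[int]_m} :=
  fun w => (w *m M == 0) && (w \in supported E).

Lemma latticeP E w : reflect (w *m M = 0 /\ w \in supported E) (w \in lattice E).
Proof. by apply: (iffP andP) => -[/eqP]. Qed.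

Lemma lattice_zmod_closed E : zmod_closed (lattice E).
Proof.
split=> [|w w' /latticeP[wM wE] /latticeP[wM' wE']]; apply/latticeP.
  by rewrite mul0mx rpred0.
by rewrite mulmxBl wM wM' subr0 rpredB.
Qed.

HB.instance Definition _ E :=
  GRing.isZmodClosed.Build 'rV[int]_m (lattice E) (lattice_zmod_closed E).

Lemma latticeS E E' w : E \subset E' -> w \in lattice E -> w \in lattice E'.
Proof. by move=> sE /latticeP[wM wE]; apply/latticeP; split=> //; apply: supportedS wE. Qed.

(* In Smith normal form M = L D R, the rows of L^-1 beyond the n-th one are killed by M. *)
Lemma int_kernel_row_free (F : fieldType) :
  exists N : 'M[int]_(m - n, m), N *m M = 0 /\ row_free (map_mx intr N : 'M[F]_(m - n, m)).
Proof.
have [le_nm|/ltnW] := leqP n m; last first.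
  rewrite -subn_eq0 => /eqP ->; exists 0; split; first exact: mul0mx.
  by rewrite -row_leq_rank leq0n.
have [L unitL [R _ [s _ ->]]] := int_Smith_normal_form M; set D := \matrix_(i, j) _.
pose f (i : 'I_(m - n)) : 'I_m := cast_ord (subnKC le_nm) (rshift n i).
have f_inj : injective f by move=> i j /cast_ord_inj/rshift_inj.
exists (rowsub f (invmx L)); split.
  rewrite mul_rowsub_mx !mulmxA mulVmx // mul1mx -mul_rowsub_mx.
  have -> : rowsub f D = 0; last exact: mul0mx.
  apply/matrixP => i j; rewrite !mxE /=; case: eqP => // eq_j.
  by have := ltn_ord j; rewrite -eq_j ltnNge leq_addr.
apply/row_freeP; exists (colsub f (map_mx intr L)).
rewrite map_mxsub mul_rowsub_mx mulmx_colsub -map_mxM mulVmx // map_mx1.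
by apply/matrixP => i j; rewrite !mxE (inj_eq f_inj).
Qed.

End IntegerLattice.

Definition binomial_row (R : nzRingType) m (u : 'X_{1..m} * 'X_{1..m}) : 'rV[R]_m :=
  mnm_row R u.1 - mnm_row R u.2.

Definition pos_part m (w : 'rV[int]_m) : 'X_{1..m} :=
  [multinom (if w 0%R i is Posz k then k else 0%N) | i < m].

Lemma binomial_row_pos_part m (w : 'rV[int]_m) :
  binomial_row int (pos_part w, pos_part (- w)) = w.
Proof.
apply/rowP => i; rewrite !mxE !mnmE mxE.
by case: (w 0 i) => [[|k]|k] /=; rewrite ?subr0 ?sub0r ?natz.
Qed.

Lemma pos_part_supported m (E : {set 'I_m}) (w : 'rV[int]_m) :
  w \in supported E -> mnm_row int (pos_part w) \in supported E.
Proof.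
move=> /supportedP wE; apply/supportedP => i; rewrite mxE mnmE => wi; apply: wE.
by apply: contra_neq wi => ->.
Qed.

Lemma mnm_row_supportedD m (E : {set 'I_m}) (a b : 'X_{1..m}) :
  mnm_row int (a + b)%MM \in supported E -> mnm_row int b \in supported E.
Proof.
move=> /supportedP abE; apply/supportedP => i bi; apply: abE; move: bi.
by rewrite !mxE mnmDE !pnatr_eq0 addn_eq0 negb_and orbC => ->.
Qed.

Section ToricLattice.
Variables (K : fieldType) (m n : nat) (d : 'I_m -> 'X_{1..n}).
Implicit Types (U : seq ('X_{1..m} * 'X_{1..m})) (E : {set 'I_m}) (w : 'rV[int]_m).
Local Notation M := (exponent_mx d int).

Definition face E : Prop := forall a b, multideg d a = multideg d b ->
  mnm_row int a \in supported E -> mnm_row int b \in supported E.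

Lemma faceT : face [set: 'I_m].
Proof. by move=> a b _ _; apply/supportedP => i _; rewrite inE. Qed.

Lemma pos_part_multideg w : w *m M = 0 -> multideg d (pos_part w) = multideg d (pos_part (- w)).
Proof.
move=> wM; apply: (@mnm_row_inj int); apply/eqP.
rewrite !mnm_row_multideg -subr_eq0 -mulmxBl -/(binomial_row int (_, _)).
by rewrite binomial_row_pos_part wM.
Qed.

Section Field.
Variable F : fieldType.

Definition face_mx U E : 'M[F]_(size U, m) :=
  \matrix_i (let u := tnth (in_tuple U) i in
             if binomial_row int u \in supported E then binomial_row F u else 0).

Lemma face_mx_invariant U E a b : face E -> relations d U ->
  mnm_row int a \in supported E ->
  relation_invariant U (fun c => (multideg d c == multideg d a) &&
    (mnm_row F c - mnm_row F b <= face_mx U E)%MS).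
Proof.
move=> faceE relU aE u Uu c; have eq_u := relU u Uu.
have multideg_cu : multideg d (c + u.1)%MM = multideg d (c + u.2)%MM by rewrite !multidegD eq_u.
rewrite multideg_cu; case: eqP => //= /esym deg_a.
have u2E := mnm_row_supportedD (faceE _ _ deg_a aE).
rewrite -multideg_cu in deg_a; have u1E := mnm_row_supportedD (faceE _ _ deg_a aE).
have u_sub : (binomial_row F u <= face_mx U E)%MS.
  have [i uE] := tnthP (in_tuple U) u Uu.
  by have := row_sub i (face_mx U E); rewrite rowK /= -uE rpredB.
have -> : mnm_row F (c + u.1)%MM - mnm_row F b =
    binomial_row F u + (mnm_row F (c + u.2)%MM - mnm_row F b).
  by rewrite !mnm_rowD /binomial_row; apply/rowP => j; rewrite !mxE; ring.
apply/idP/idP => sub; last exact: addmx_sub.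
by rewrite -[X in (X <= _)%MS](addKr (binomial_row F u)) addmx_sub // eqmx_opp.
Qed.

Lemma lattice_face_mx U E w : binomial_generators K d U -> face E -> w \in lattice M E ->
  (map_mx intr w <= face_mx U E)%MS.
Proof.
move=> [relU genU] faceE /latticeP[wM wE]; set a := pos_part w; set b := pos_part (- w).
have deg_ab : multideg d a = multideg d b := pos_part_multideg wM.
have := face_mx_invariant b faceE relU (pos_part_supported wE).
move/relation_invariant_span => /(_ K a b); rewrite -/a deg_ab !eqxx subrr sub0mx /=.
have -> : map_mx intr w = mnm_row F a - mnm_row F b.
  rewrite -[w]binomial_row_pos_part; apply/rowP => i; rewrite !mxE.
  by rewrite rmorphB /= !natz.
by apply; apply: genU; apply/toric_kernel_binomial.
Qed.

End Field.

Hypothesis exponent_full : row_full (exponent_mx d rat).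

Lemma generators_row_free (F : fieldType) U h :
  prime_chain_to (toric_kernel (K := K) d) h -> binomial_generators K d U -> (size U <= h)%N ->
  row_free (face_mx F U setT).
Proof.
move=> chain_h genU le_Uh.
have [N [NM freeN]] := int_kernel_row_free M F.
have sub_N : (map_mx intr N <= face_mx F U setT)%MS.
  apply/row_subP => i; rewrite -map_row; apply: lattice_face_mx genU faceT _.
  apply/latticeP; split; first by rewrite -row_mul NM row0.
  by apply/supportedP => j _; rewrite inE.
rewrite -row_leq_rank; apply: leq_trans (mxrankS sub_N); rewrite (eqP freeN).
apply: leq_trans le_Uh _; have := toric_chain_leq chain_h.
by rewrite (eqP exponent_full); lia.
Qed.

Definition face_basis (F : fieldType) k (B : 'M[int]_(k, m)) : Prop :=
  [/\ B *m M = 0, row_free (map_mx intr B : 'M[F]_(k, m)) &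
      forall E w, face E -> w \in lattice M E ->
        exists l : 'rV[F]_k, map_mx intr w = l *m map_mx intr B /\
          forall i, l 0 i != 0 -> row i B \in supported E].

Lemma toric_ci_face_basis (F : fieldType) r h : (0 < r)%N -> (forall i, mdeg (d i) = r) ->
  generated_by (toric_kernel (K := K) d) h -> prime_chain_to (toric_kernel (K := K) d) h ->
  exists k (B : 'M[int]_(k, m)), face_basis F B.
Proof.
move=> r_gt0 mdeg_d gen_h chain_h.
have [U genU le_Uh] := binomial_generators_leq r_gt0 mdeg_d gen_h.
pose u i := tnth (in_tuple U) i; pose B : 'M[int]_(size U, m) := \matrix_i binomial_row int (u i).
have map_B i : row i (map_mx intr B) = binomial_row F (u i).
  by apply/rowP => j; rewrite !mxE rmorphB /= !natz.
have B_face_mx : map_mx intr B = face_mx F U setT.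
  apply/row_matrixP => i; rewrite map_B rowK.
  by rewrite /= ifT //; apply/supportedP => j; rewrite inE.
exists (size U), B; split=> [||E w faceE wE].
- apply/row_matrixP => i; rewrite row_mul rowK row0 mulmxBl -!mnm_row_multideg.
  by case: genU => relU _; rewrite relU ?subrr // mem_tnth.
- by rewrite B_face_mx; apply: generators_row_free chain_h genU le_Uh.
have /submxP[l lE] := lattice_face_mx F genU faceE wE.
exists (\row_i (if row i B \in supported E then l 0 i else 0)); split=> [|i]; last first.
  by rewrite mxE; case: ifP => //; rewrite eqxx.
rewrite lE !mulmx_sum_row; apply: eq_bigr => i _; rewrite map_B mxE !rowK /=.
by case: ifP; rewrite ?scaler0 ?scale0r.
Qed.

Section Distributivity.
Variables (p k : nat) (B : 'M[int]_(k, m)).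
Hypothesis basisB : face_basis 'F_p B.
Local Notation red := (map_mx (intr : int -> 'F_p)).

Lemma face_basis_lift E (l : 'rV['F_p]_k) :
  (forall i, l 0 i != 0 -> row i B \in supported E) ->
  exists2 w, w \in lattice M E & red w = l *m red B.
Proof.
move=> lE; pose z := map_mx (fun x : 'F_p => (x : nat)%:Z) l; exists (z *m B).
  apply/latticeP; split; first by have [BM _ _] := basisB; rewrite -mulmxA BM mulmx0.
  rewrite mulmx_sum_row; apply: rpred_sum => i _; rewrite mxE.
  have [->|/lE rowE] := eqVneq (l 0 i) 0; first by rewrite scale0r rpred0.
  by rewrite -natz scaler_nat rpredMn.
rewrite map_mxM; congr (_ *m _); apply/rowP => i; rewrite !mxE; exact: natr_Zp.
Qed.

(* Cut the coordinates of w1 and w2 in the basis B down to those that occur in w. *)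
Lemma lattice_distributive E E1 E2 w w1 w2 : face E -> face E1 -> face E2 ->
  w \in lattice M E -> w1 \in lattice M E1 -> w2 \in lattice M E2 ->
  red w = red w1 + red w2 ->
  exists w1' w2', [/\ w1' \in lattice M (E :&: E1), w2' \in lattice M (E :&: E2) &
    red w = red w1' + red w2'].
Proof.
move=> faceE faceE1 faceE2 wE wE1 wE2; have [_ freeB span] := basisB.
have [l [-> lE]] := span _ _ faceE wE; have [l1 [-> lE1]] := span _ _ faceE1 wE1.
have [l2 [-> lE2]] := span _ _ faceE2 wE2; rewrite -mulmxDl => /(row_free_inj freeB) l_sum.
pose cut (l' : 'rV['F_p]_k) : 'rV['F_p]_k := \row_i (if l 0 i == 0 then 0 else l' 0 i).
have cut_supported E' (l' : 'rV['F_p]_k) : (forall i, l' 0 i != 0 -> row i B \in supported E') ->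
    forall i, cut l' 0 i != 0 -> row i B \in supported (E :&: E').
  move=> lE' i; rewrite mxE; have [_|li] := eqVneq (l 0 i) 0; first by rewrite eqxx.
  by move=> /lE'; apply: supportedI; apply: lE.
have [w1' w1E' redE1] := face_basis_lift (cut_supported _ _ lE1).
have [w2' w2E' redE2] := face_basis_lift (cut_supported _ _ lE2).
exists w1', w2'; split=> //; rewrite redE1 redE2 -mulmxDl; congr (_ *m _).
apply/rowP => i; have /rowP/(_ i) := l_sum; rewrite !mxE.
by case: eqP => [-> _|//]; rewrite addr0.
Qed.

End Distributivity.

End ToricLattice.

(** * The incidence lattice of a graph *)

Lemma induced_connectedP (T : finType) (e : rel T) (S : {set T}) x y :
  induced_connected e S -> x \in S -> y \in S -> connect (induced_rel e S) x y.
Proof. by case/andP=> _ /forall_inP conS /conS/forall_inP; apply. Qed.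

Lemma induced_connectS (T : finType) (e : rel T) (X Y : {set T}) x y : X \subset Y ->
  connect (induced_rel e X) x y -> connect (induced_rel e Y) x y.
Proof.
move=> /subsetP sXY; apply: connect_sub => a b /and3P[eab Xa Xb].
by apply: connect1; rewrite /induced_rel eab !sXY.
Qed.

Section Incidence.
Variables (T : finType) (e : rel T).
Local Notation m := (nedges e).
Implicit Types (S : {set T}) (x y : T) (w : 'rV[int]_m).

Definition edge (i : 'I_m) : T * T := tnth (in_tuple (edges e)) i.

Lemma edge_rel i : e (edge i).1 (edge i).2.
Proof. by have := mem_tnth i (in_tuple (edges e)); rewrite mem_filter => /andP[/andP[]]. Qed.

Definition edge_exponent (i : 'I_m) : 'X_{1..#|T|} :=
  (U_(enum_rank (edge i).1) + U_(enum_rank (edge i).2))%MM.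

Lemma mdeg_edge_exponent i : mdeg (edge_exponent i) = 2.
Proof. by rewrite mdegD !mdeg1. Qed.

Lemma toric_ideal_mpoly (K : fieldType) (p : {mpoly K[m]}) :
  toric_ideal (e := e) (iter_of_mpoly p) <-> toric_kernel edge_exponent p.
Proof.
rewrite /toric_kernel /toric_ideal.
have -> : monomial_map edge_exponent p = mpoly_of_iter (toric_map (iter_of_mpoly p)).
  pose toric : {rmorphism Defs.mpoly K m -> Defs.mpoly K #|T|} :=
    Defs.meval (@mconst K #|T|) (nth 0 [seq mvar K #|T| (enum_rank xy.1) *
      mvar K #|T| (enum_rank xy.2) | xy <- edges e]).
  apply: (mpoly_rmorph_ext (f := monomial_map edge_exponent)
    (g := @mpoly_of_iter K #|T| \o toric \o @iter_of_mpoly K m)) => [c|i] /=.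
    by rewrite /monomial_map mmapC iter_of_mpolyC iter_meval_const mpoly_of_iter_const.
  rewrite monomial_mapX iter_of_mpolyX iter_meval_var // (nth_map (edge i)) //.
  rewrite rmorphM /= !mpoly_of_iter_var -mpolyXD -(tnth_nth _ (in_tuple (edges e))).
  rewrite /multideg (bigD1 i) //= mnm1E eqxx mulm1n big1 ?addm0 // => j /negbTE ij.
  by rewrite mnm1E eq_sym ij mulm0n.
by split=> [-> | p0]; rewrite ?rmorph0 // -[LHS]mpoly_of_iterK p0 rmorph0.
Qed.

Lemma toric_ideal_kernel (K : fieldType) :
  @toric_ideal _ e K = toric_kernel edge_exponent \o @mpoly_of_iter K m.
Proof. by apply/funext => p; apply/propext; rewrite /= -toric_ideal_mpoly mpoly_of_iterK. Qed.

Lemma complete_intersection_toric_kernel (K : fieldType) : complete_intersection e K ->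
  exists h, generated_by (toric_kernel (K := K) edge_exponent) h /\
    prime_chain_to (toric_kernel (K := K) edge_exponent) h.
Proof.
pose I := @toric_ideal _ e K; case=> h [[minI _] genI]; exists h.
have eqI : toric_kernel edge_exponent = I \o @iter_of_mpoly K m.
  by apply/funext => p; apply/propext; rewrite /I /= toric_ideal_mpoly.
rewrite eqI; split.
  exact: (preimage_generated_by (@iter_of_mpolyK K m) (@mpoly_of_iterK K m)).
apply: (preimage_prime_chain (@mpoly_of_iterK K m)).
apply: minI => //; rewrite -/I [I]toric_ideal_kernel.
exact/preimage_is_prime/toric_kernel_prime.
Qed.

Definition edges_in S : {set 'I_m} := [set i | ((edge i).1 \in S) && ((edge i).2 \in S)].

Lemma edges_inS S S' : S \subset S' -> edges_in S \subset edges_in S'.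
Proof.
by move=> /subsetP sS; apply/subsetP => i; rewrite !inE => /andP[/sS -> /sS ->].
Qed.

Lemma edges_inI S S' : edges_in (S :&: S') = edges_in S :&: edges_in S'.
Proof. by apply/setP => i; rewrite !inE andbACA. Qed.

Lemma supported_edges_inS S S' w :
  S \subset S' -> w \in supported (edges_in S) -> w \in supported (edges_in S').
Proof. by move=> /edges_inS; apply: supportedS. Qed.

(* An edge used by b ends at vertices of positive degree in b, hence in a. *)
Lemma edges_in_face S : face edge_exponent (edges_in S).
Proof.
move=> a b eq_deg /supportedP aS; apply/supportedP => i; rewrite mxE => bi.
suff endS x : edge_exponent i (enum_rank x) != 0%N -> x \in S.
  by rewrite inE !endS // mnmDE !mnm1E eqxx // addnC.
move=> ix; have : multideg edge_exponent a (enum_rank x) != 0%N.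
  rewrite eq_deg mnm_sumE (bigD1 i) //= mulmnE addn_eq0 muln_eq0 negb_and negb_or ix.
  by rewrite pnatr_eq0 in bi; rewrite bi.
rewrite mnm_sumE sum_nat_eq0 negb_forall => /existsP[j].
rewrite mulmnE muln_eq0 negb_or => /andP[jx aj].
have : j \in edges_in S by apply: aS; rewrite mxE pnatr_eq0.
rewrite inE => /andP[j1 j2]; move: jx; rewrite mnmDE !mnm1E !(inj_eq enum_rank_inj).
by have [<-|_] := eqVneq (edge j).1 x => //; have [<-|] := eqVneq (edge j).2 x.
Qed.

Definition vtx x : 'rV[int]_#|T| := delta_mx 0 (enum_rank x).

Definition incidence : 'M[int]_(m, #|T|) := exponent_mx edge_exponent int.

Lemma row_incidence i : row i incidence = vtx (edge i).1 + vtx (edge i).2.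
Proof.
by apply/rowP => j; rewrite !mxE mnmDE !mnm1E natrD ![j == _]eq_sym.
Qed.

Definition potential (f : T -> int) : 'cV[int]_#|T| := \col_j f (enum_val j).

Lemma vtx_potential x f : (vtx x *m potential f) 0 0 = f x.
Proof. by rewrite -rowE !mxE enum_rankK. Qed.

Lemma incidence_potential w f :
  \sum_i w 0 i * (f (edge i).1 + f (edge i).2) = (w *m incidence *m potential f) 0 0.
Proof.
rewrite -mulmxA mxE; apply: eq_bigr => i _; congr (_ * _).
have /rowP/(_ 0) := row_mul i incidence (potential f).
by rewrite [LHS]mxE row_incidence mulmxDl [RHS]mxE !vtx_potential => ->.
Qed.

Definition cycle_lattice S : {pred 'rV[int]_m} := lattice incidence (edges_in S).

HB.instance Definition _ S := GRing.ZmodClosed.on (cycle_lattice S).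

End Incidence.

Definition F2_distributive (T : finType) (e : rel T) : Prop :=
  forall (S S1 S2 : {set T}) (w w1 w2 : 'rV[int]_(nedges e)),
    w \in cycle_lattice S -> w1 \in cycle_lattice S1 -> w2 \in cycle_lattice S2 ->
    map_mx intr w = map_mx intr w1 + map_mx intr w2 :> 'rV['F_2]_(nedges e) ->
    exists w1' w2', [/\ w1' \in cycle_lattice (S :&: S1), w2' \in cycle_lattice (S :&: S2) &
      map_mx intr w = map_mx intr w1' + map_mx intr w2' :> 'rV['F_2]_(nedges e)].

Lemma complete_intersection_distributive (T : finType) (e : rel T) (K : fieldType) :
  complete_intersection e K ->
  (forall x, exists w, w *m incidence e = vtx x *+ 2) -> F2_distributive e.
Proof.
move=> /complete_intersection_toric_kernel[h [gen_h chain_h]] double.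
have full : row_full (exponent_mx (@edge_exponent T e) rat).
  rewrite -sub1mx; apply/row_subP => j; rewrite row1.
  have [w wE] := double (enum_val j); apply/submxP; exists (2^-1 *: map_mx intr w).
  have -> : exponent_mx (@edge_exponent T e) rat = map_mx intr (incidence e).
    by apply/matrixP => i k; rewrite !mxE rmorph_nat.
  rewrite -scalemxAl -map_mxM wE /vtx enum_valK raddfMn /= map_delta_mx.
  by rewrite -scaler_nat scalerA mulVf ?scale1r.
have [k [B basisB]] :=
  toric_ci_face_basis full 'F_2 (isT : 0 < 2)%N (@mdeg_edge_exponent T e) gen_h chain_h.
move=> S S1 S2 w w1 w2; rewrite /cycle_lattice !edges_inI.
by apply: (lattice_distributive basisB); apply: edges_in_face.
Qed.

(** * Odd closed walks *)

Section OddSets.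
Variables (T : finType) (e : rel T).
Hypotheses (e_sym : symmetric e) (e_irr : irreflexive e).
Local Notation m := (nedges e).
Local Notation M := (incidence e).
Local Notation red := (map_mx (intr : int -> 'F_2)).
Implicit Types (S D P Q : {set T}) (x y c : T) (w q : 'rV[int]_m) (v : 'rV[int]_#|T|).

Lemma edge_exists x y : e x y -> exists i : 'I_m, edge i = (x, y) \/ edge i = (y, x).
Proof.
wlog lt_xy : x y / (enum_rank x < enum_rank y)%N => [wl exy|exy].
  case: (ltngtP (enum_rank x) (enum_rank y)) => [lt|lt|/val_inj/enum_rank_inj eqxy].
  - exact: wl.
  - by have [|i [Hi|Hi]] := wl _ _ lt; [rewrite e_sym | exists i; right | exists i; left].
  - by rewrite eqxy e_irr in exy.
have : (x, y) \in edges e by rewrite mem_filter /= exy lt_xy allpairs_f ?mem_enum.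
by move=> /(tnthP (in_tuple _))[i xyE]; exists i; left.
Qed.

Definition boundary_in S v : Prop := exists2 w, w \in supported (edges_in e S) & w *m M = v.

Lemma boundary_inD S v v' : boundary_in S v -> boundary_in S v' -> boundary_in S (v + v').
Proof.
by move=> [w wS <-] [w' wS' <-]; exists (w + w'); rewrite ?rpredD // mulmxDl.
Qed.

Lemma boundary_inB S v v' : boundary_in S v -> boundary_in S v' -> boundary_in S (v - v').
Proof.
by move=> [w wS <-] [w' wS' <-]; exists (w - w'); rewrite ?rpredB // mulmxBl.
Qed.

Lemma boundary_in_edge S x y : induced_rel e S x y -> boundary_in S (vtx x + vtx y).
Proof.
move=> /and3P[exy Sx Sy]; have [i iE] := edge_exists exy.
exists (delta_mx 0 i); last by rewrite -rowE row_incidence; case: iE => -> //=; rewrite addrC.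
apply/supportedP => j; rewrite mxE /=; have [-> _|//] := eqVneq j i.
by rewrite inE; case: iE => -> /=; rewrite Sx Sy.
Qed.

Lemma boundary_in_connect S x y : connect (induced_rel e S) x y ->
  boundary_in S (vtx x - vtx y) \/ boundary_in S (vtx x + vtx y).
Proof.
case/connectP=> s + ->; elim: s x => [|z s IHs] x /=.
  by left; rewrite subrr; exists 0; rewrite ?rpred0 ?mul0mx.
case/andP=> /boundary_in_edge bxz /IHs[] bz; [right | left].
  have -> : vtx x + vtx (last z s) = vtx x + vtx z - (vtx z - vtx (last z s)).
    by rewrite opprB addrA addrAC addrK.
  exact: boundary_inB.
have -> : vtx x - vtx (last z s) = vtx x + vtx z - (vtx z + vtx (last z s)).
  by rewrite opprD addrA addrK.
exact: boundary_inB.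
Qed.

Definition odd_closed S c w : Prop :=
  w \in supported (edges_in e S) /\ w *m M = vtx c *+ 2.

(* If no odd closed walk passes through c, then the vertices joined to c by walks of even
   length are one side of a bipartition of S. *)
Lemma odd_closed_exists S c : induced_connected e S -> ~~ bipartite_on e S -> c \in S ->
  exists w, odd_closed S c w.
Proof.
move=> conS nbipS Sc; suff [w wS wc] : boundary_in S (vtx c *+ 2) by exists w.
apply: contrapT => no_odd; case/negP: nbipS.
pose even z := `[< boundary_in S (vtx z - vtx c) >].
have oddP z : z \in S -> ~~ even z -> boundary_in S (vtx z + vtx c).
  by move=> Sz /asboolPn nev; case: (boundary_in_connect (induced_connectedP conS Sz Sc)).
apply/existsP; exists [ffun z => even z].
apply/forall_inP => x Sx; apply/forall_inP => y Sy; apply/implyP => exy; rewrite !ffunE.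
apply: contra_notN no_odd => /eqP eq_even.
have bxy : boundary_in S (vtx x + vtx y) by apply: boundary_in_edge; apply/and3P.
have [ev|nev] := boolP (even x).
  have /asboolP bx := ev; have /asboolP b_y : even y by rewrite -eq_even.
  have -> : vtx c *+ 2 = vtx x + vtx y - (vtx x - vtx c) - (vtx y - vtx c).
    by apply/rowP => j; rewrite !mxE; ring.
  by apply: boundary_inB => //; apply: boundary_inB.
have -> : vtx c *+ 2 = vtx x + vtx c + (vtx y + vtx c) - (vtx x + vtx y).
  by apply/rowP => j; rewrite !mxE; ring.
by apply: boundary_inB => //; apply: boundary_inD; apply: oddP; rewrite -?eq_even.
Qed.

Lemma red_opp w : red (- w) = red w.
Proof. by apply/rowP => i; rewrite !mxE rmorphN /= oppr_pchar2 ?pchar_Fp. Qed.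

Lemma red_double w : red (w *+ 2) = 0.
Proof. by apply/rowP => i; rewrite mulr2n !mxE rmorphD /= addrr_pchar2 ?pchar_Fp. Qed.

Lemma odd_closed_transport S P c c' w :
  odd_closed S c w -> connect (induced_rel e P) c c' ->
  exists2 w', odd_closed (S :|: P) c' w' & red w' = red w.
Proof.
move=> [/(supported_edges_inS (subsetUl S P)) wS wc] conP.
have [] := boundary_in_connect conP => -[p /(supported_edges_inS (subsetUr S P)) pP pc].
  exists (w - p *+ 2); last by rewrite raddfB /= red_double subr0.
  split; first by rewrite rpredB // rpredMn.
  by rewrite mulmxBl wc [p *+ 2]mulr2n mulmxDl pc -mulr2n mulrnBl subKr.
exists (p *+ 2 - w); last by rewrite raddfB /= red_double sub0r -[RHS]red_opp raddfN.
split; first by rewrite rpredB // rpredMn.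
by rewrite mulmxBl wc [p *+ 2]mulr2n mulmxDl pc -mulr2n mulrnDl addrC addKr.
Qed.

Lemma odd_closedS S S' c w : S \subset S' -> odd_closed S c w -> odd_closed S' c w.
Proof. by move=> sS [wS wc]; split=> //; apply: supported_edges_inS wS. Qed.

Lemma odd_closed_sum w c : w *m M = vtx c *+ 2 -> \sum_i w 0 i = 1.
Proof.
move=> wc; have := incidence_potential w (fun=> 1); rewrite wc mulr2n mulmxDl mxE vtx_potential.
by rewrite -mulr_suml -[RHS](mul1r (1 + 1)) => /(mulIf _); apply.
Qed.

(* The potential f makes the coordinates of w on the edges in A sum to 0, while the
   coordinates of q sum to 1. *)
Lemma parity_contradiction (A : {set 'I_m}) (f : T -> int) w q c :
  w *m M = 0 -> q *m M = vtx c *+ 2 ->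
  (forall i, w 0 i != 0 -> f (edge i).1 + f (edge i).2 = (i \in A)%:R *+ 2) ->
  (forall i, red q 0 i = if i \in A then red w 0 i else 0) -> False.
Proof.
move=> wM /odd_closed_sum q1 fA red_q.
have sumA : \sum_(i in A) w 0 i = 0.
  have := incidence_potential w f; rewrite wM mul0mx mxE => pot0.
  suff : (\sum_(i in A) w 0 i) * 2 = 0 by lia.
  rewrite mulr_suml big_mkcond -[RHS]pot0; apply: eq_bigr => i _.
  have [->|/fA ->] := eqVneq (w 0 i) 0; first by rewrite !mul0r if_same.
  by case: (i \in A); rewrite ?mul0rn ?mulr0.
have : \sum_i red q 0 i = 0.
  rewrite (eq_bigr _ (fun i _ => red_q i)) -big_mkcond -[RHS](rmorph0 (intr : int -> 'F_2)).
  by rewrite -sumA rmorph_sum; apply: eq_bigr => i _; rewrite mxE.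
rewrite (eq_bigr (fun i => (q 0 i)%:~R)) => [|i _]; last by rewrite mxE.
by rewrite -rmorph_sum q1.
Qed.

Lemma cycle_latticeS S S' w : S \subset S' -> w \in cycle_lattice S -> w \in cycle_lattice S'.
Proof. by move=> sS; apply: latticeS; apply: edges_inS. Qed.

Lemma odd_closed_sub S c q q' :
  odd_closed S c q -> odd_closed S c q' -> q - q' \in cycle_lattice S.
Proof. by move=> [qS qc] [qS' qc']; apply/latticeP; rewrite rpredB // mulmxBl qc qc' subrr. Qed.

Hypothesis distributive : F2_distributive e.

Lemma joined_cycle S1 S2 P c1 c2 q1 q2 :
  odd_closed S1 c1 q1 -> odd_closed S2 c2 q2 -> connect (induced_rel e P) c1 c2 ->
  exists2 w, w \in cycle_lattice (S1 :|: P :|: S2) & red w = red q1 + red q2.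
Proof.
move=> odd1 odd2 conP; have [q1' odd1' red1] := odd_closed_transport odd1 conP.
exists (q1' - q2); last by rewrite raddfD /= red1 red_opp.
by apply: (@odd_closed_sub _ c2); [apply: odd_closedS odd1' | apply: odd_closedS odd2];
  rewrite ?subsetUl ?subsetUr.
Qed.

(* Otherwise let X be the component of c1 in the intersection Y: by distributivity q1 + q2
   is congruent to a lattice vector on Y, whose part on X is congruent to q1. *)
Lemma common_connection S1 S2 P Q c1 c2 q1 q2 (Y := (S1 :|: P :|: S2) :&: (S1 :|: Q :|: S2)) :
  induced_connected e S1 -> induced_connected e S2 -> c1 \in S1 -> c2 \in S2 ->
  odd_closed S1 c1 q1 -> odd_closed S2 c2 q2 ->
  connect (induced_rel e P) c1 c2 -> connect (induced_rel e Q) c1 c2 ->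
  connect (induced_rel e Y) c1 c2.
Proof.
move=> conS1 conS2 S1c1 S2c2 odd1 odd2 conP conQ.
have [wP wP_in redP] := joined_cycle odd1 odd2 conP.
have [wQ wQ_in redQ] := joined_cycle odd1 odd2 conQ.
have [|a [b [aY b0 red_ab]]] := distributive wP_in wQ_in (rpred0 (cycle_lattice set0)).
  by rewrite redP redQ raddf0 addr0.
rewrite setI0 in b0; have {aY b0} abY : a + b \in cycle_lattice Y.
  by rewrite rpredD //; apply: cycle_latticeS b0; apply: sub0set.
have /latticeP[abM ab_supp] := abY.
apply: contraT => not_con; exfalso; pose X := [set x | connect (induced_rel e Y) c1 x].
have S1X x : x \in S1 -> x \in X.
  move=> S1x; rewrite inE; apply: induced_connectS (induced_connectedP conS1 S1c1 S1x).
  by rewrite subsetI -!setUA !subsetUl.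
have S2X x : x \in S2 -> x \notin X.
  move=> S2x; rewrite inE; apply: contra not_con => c1x; apply: connect_trans c1x _.
  apply: induced_connectS (induced_connectedP conS2 S2x S2c2).
  by rewrite subsetI !subsetUr.
have XE i : (a + b) 0 i != 0 -> ((edge i).1 \in X) = ((edge i).2 \in X).
  move/supportedP: ab_supp => /[apply]; rewrite inE => /andP[Y1 Y2]; rewrite !inE.
  have e12 := edge_rel i; apply/idP/idP => c1x; apply: connect_trans c1x (connect1 _).
    by rewrite /induced_rel e12 Y1.
  by rewrite /induced_rel e_sym e12 Y2.
apply: (parity_contradiction (f := fun x => (x \in X)%:R) (A := edges_in e X) abM odd1.2) => i.
  by move/XE => X12; rewrite [i \in _]inE X12 andbb mulr2n.
have -> : red (a + b) = red q1 + red q2 by rewrite raddfD /= -red_ab.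
rewrite !mxE [i \in _]inE; have [/andP[X1 X2]|nX12] := boolP (_ && _).
  rewrite [q2 0 i](supported_eq0 odd2.1) ?addr0 // [i \in _]inE.
  by apply/negP => /andP[/S2X]; rewrite X1.
rewrite [q1 0 i](supported_eq0 odd1.1) // [i \in _]inE.
by apply: contra nX12 => /andP[/S1X -> /S1X ->].
Qed.

(* The potential alternates along P with value 1 at c, and is 1 elsewhere: the edges of P
   cancel, and all other edges used by a have potential 2. *)
Lemma bipartite_parity_contradiction S1 S2 P c q1 q2 a b :
  bipartite_on e P -> c \in P -> S1 :&: P \subset [set c] -> S1 :&: S2 \subset P ->
  (forall x y, x \in S1 -> x \notin P -> y \in P -> y != c -> ~~ e x y) ->
  odd_closed S1 c q1 -> q2 \in supported (edges_in e S2) ->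
  a \in cycle_lattice (S1 :|: P) -> b \in supported (edges_in e (S2 :|: P)) ->
  red q1 + red q2 = red a + red b -> False.
Proof.
move=> /existsP[chi chiP] Pc S1P S12 cross [q1S q1c] q2S /latticeP[aM aS] bS red_eq.
pose f x : int := if x \in P then (-1) ^+ (chi x (+) chi c) else 1.
have f_attach x y :
    e x y -> x \notin P -> x \in S1 :|: P -> y \in S1 :|: P -> f x + f y = 1 *+ 2.
  move=> exy nPx; rewrite !inE (negbTE nPx) orbF => S1x _; rewrite /f (negbTE nPx).
  have [Py|//] := boolP (y \in P); have [->|neq_yc] := eqVneq y c; first by rewrite addbb.
  by have := cross x y S1x nPx Py neq_yc; rewrite exy.
apply: (parity_contradiction (f := f) (A := ~: edges_in e P) aM q1c) => i.
  move/supportedP: aS => /[apply]; rewrite [i \in _]inE => /andP[i1 i2].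
  have e12 := edge_rel i; rewrite [i \in _]in_setC [i \in _]inE.
  have [P1|nP1] /= := boolP ((edge i).1 \in P); last exact: f_attach.
  have [P2|nP2] /= := boolP ((edge i).2 \in P); last first.
    by rewrite addrC; apply: f_attach => //; rewrite e_sym.
  have := implyP (forall_inP (forall_inP chiP _ P1) _ P2) e12; rewrite /f P1 P2.
  by case: (chi _) (chi _) (chi c) => -[] [].
rewrite in_setC; have [iP|niP] /= := boolP (i \in edges_in e P).
  rewrite mxE (supported_eq0 q1S) //; apply/negP; rewrite inE => /andP[i1 i2].
  move: iP; rewrite inE => /andP[P1 P2].
  have eq_c x : x \in S1 -> x \in P -> x = c.
    by move=> S1x Px; apply/set1P/(subsetP S1P); rewrite inE S1x.
  by have := edge_rel i; rewrite (eq_c _ i1 P1) (eq_c _ i2 P2) e_irr.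
have sub_edges : edges_in e (S1 :|: P) :&: edges_in e (S2 :|: P) \subset edges_in e P.
  by rewrite -edges_inI edges_inS // -setUIl subUset S12 /=.
have /rowP/(_ i) := red_eq; rewrite !mxE => red_i.
have [iS1|niS1] := boolP (i \in edges_in e (S1 :|: P)).
  have niS2 : i \notin edges_in e (S2 :|: P).
    by apply: contra niP => iS2; apply: (subsetP sub_edges); rewrite inE iS1.
  rewrite (supported_eq0 bS niS2) (supported_eq0 q2S) ?addr0 // in red_i.
  exact: contra (subsetP (edges_inS e (subsetUl S2 P)) i) niS2.
rewrite (supported_eq0 aS niS1) (supported_eq0 q1S) //.
exact: contra (subsetP (edges_inS e (subsetUl S1 P)) i) niS1.
Qed.

Lemma odd_sets_attached_contradiction D P S1 S2 c1 c2 q1 q2 r :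
  P \subset D -> bipartite_on e P -> c1 \in P -> c2 \in P -> connect (induced_rel e P) c1 c2 ->
  S1 :&: D = [set c1] -> S2 :&: D = [set c2] -> S1 :&: S2 \subset P ->
  (forall x y, x \in S1 -> x != c1 -> y \in D -> y != c1 -> ~~ e x y) ->
  odd_closed D c1 r -> odd_closed S1 c1 q1 -> odd_closed S2 c2 q2 -> False.
Proof.
move=> sPD bipP Pc1 Pc2 conP S1D S2D S12 cross oddD odd1 odd2.
have [w wS red_w] := joined_cycle odd1 odd2 conP.
have [r' oddD' red_r] := odd_closed_transport oddD conP; rewrite (setUidPl sPD) in oddD'.
have cycle_sub S c q p :
    odd_closed S c q -> odd_closed D c p -> q - p \in cycle_lattice (S :|: D).
  move=> oddq oddp; apply: odd_closed_sub.
    exact: odd_closedS (subsetUl _ _) oddq.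
  exact: odd_closedS (subsetUr _ _) oddp.
have lat1 := cycle_sub _ _ _ _ odd1 oddD; have lat2 := cycle_sub _ _ _ _ odd2 oddD'.
have [|a [b [aS bS red_ab]]] := distributive wS lat1 lat2.
  rewrite red_w !raddfD /= !red_opp red_r addrACA.
  by rewrite -[red r + _]mulr2n -raddfMn /= red_double addr0.
have in_D S c x : S :&: D = [set c] -> x \in S -> x \in D -> x = c.
  by move=> SD Sx Dx; apply/set1P; rewrite -SD inE Sx.
have aSP : a \in cycle_lattice (S1 :|: P).
  apply: cycle_latticeS aS; apply/subsetP => x; rewrite !inE => /andP[x_in /orP[-> //|Dx]].
  by case/orP: x_in => [//|S2x]; rewrite (in_D _ _ _ S2D S2x Dx) Pc2 orbT.
have /latticeP[_ bSP] : b \in cycle_lattice (S2 :|: P).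
  apply: cycle_latticeS bS; apply/subsetP => x; rewrite !inE => /andP[x_in /orP[-> //|Dx]].
  case/orP: x_in => [/orP[S1x|->]|-> //]; last by rewrite orbT.
  by rewrite (in_D _ _ _ S1D S1x Dx) Pc1 orbT.
apply: (bipartite_parity_contradiction bipP Pc1 _ S12 _ odd1 odd2.1 aSP bSP).
- by rewrite -S1D setIS.
- move=> x y S1x nPx Py; apply: cross => //; last exact: (subsetP sPD).
  by apply: contraNneq nPx => ->.
- by rewrite -red_w.
Qed.

End OddSets.

(** * Minimal connections *)

Section Connections.
Local Open Scope nat_scope.
Variables (T : finType) (e : rel T).
Hypotheses (e_sym : symmetric e) (e_irr : irreflexive e).
Implicit Types (B D P X Y : {set T}) (x y z v : T) (s : seq T).

Lemma induced_connect_sym X x y :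
  connect (induced_rel e X) x y = connect (induced_rel e X) y x.
Proof.
by apply/sym_connect_sym => u v; rewrite /induced_rel e_sym; congr (_ && _); rewrite andbC.
Qed.

Lemma induced_path_sub X x s : path (induced_rel e X) x s -> x \in X -> {subset x :: s <= X}.
Proof.
elim: s x => [|z s IHs] x /=; first by move=> _ Xx u; rewrite inE => /eqP->.
by case/andP=> /and3P[_ _ Xz] /IHs/(_ Xz) sX Xx u; rewrite inE => /orP[/eqP->|/sX].
Qed.

Lemma nth_path_connect X x s i j : path e x s -> i <= j <= size s ->
  (forall k, i <= k <= j -> nth x (x :: s) k \in X) ->
  connect (induced_rel e X) (nth x (x :: s) i) (nth x (x :: s) j).
Proof.
move=> /(pathP x) ps; elim: j => [|j IHj] /andP[le_ij le_js] sX.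
  by move: le_ij; rewrite leqn0 => /eqP->.
move: le_ij; rewrite leq_eqVlt => /orP[/eqP<- //|le_ij].
apply: connect_trans (connect1 _); last first.
  by apply/and3P; split; [apply: ps | apply: sX | apply: sX]; lia.
by apply: IHj => [|k /andP[ik kj]]; rewrite ?sX //; lia.
Qed.

Lemma path_induced_connect X x s : path e x s -> {subset x :: s <= X} ->
  connect (induced_rel e X) x (last x s).
Proof.
move=> ps sX; rewrite (last_nth x).
apply: (@nth_path_connect _ _ _ 0); rewrite ?leqnn // => k /andP[_ ks].
exact/sX/mem_nth.
Qed.

Lemma segment_connect x s v i j : path e x s -> uniq (x :: s) -> i <= j <= size s ->
  ~~ (i <= index v (x :: s) <= j) ->
  connect (induced_rel e ([set z in x :: s] :\ v)) (nth x (x :: s) i) (nth x (x :: s) j).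
Proof.
move=> ps us ij v_out; apply: nth_path_connect => // k ikj.
have ks : k < size (x :: s) by move: ij ikj => /=; lia.
rewrite in_setD1 inE mem_nth // andbT; apply: contraNneq v_out => <-.
by rewrite index_uniq.
Qed.

Lemma uniq_path_avoid x s z v : path e x s -> uniq (x :: s) -> z \in x :: s -> z != v ->
  exists c, [/\ c \in [:: x; last x s], c != v &
    connect (induced_rel e ([set y in x :: s] :\ v)) z c].
Proof.
move=> ps us sz neq_zv; have zE := nth_index x sz; set i := index z (x :: s) in zE.
have lt_i : i < size (x :: s) by rewrite index_mem.
have vi : index v (x :: s) != i.
  apply: contraNneq neq_zv => eq_i; rewrite -zE -eq_i nth_index //.
  by rewrite -index_mem eq_i.
have [lt_iv|le_vi] := ltnP i (index v (x :: s)).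
  exists x; rewrite inE eqxx -zE; split=> //.
    by apply: contraTneq lt_iv => <-; rewrite /= eqxx.
  rewrite induced_connect_sym; apply: (@segment_connect _ _ _ 0) => //.
  by rewrite -ltnNge.
have v_lt : index v (x :: s) < i by rewrite ltn_neqAle vi.
exists (last x s); rewrite !inE eqxx orbT; split=> //.
  by apply: contraTneq v_lt => <-; rewrite index_last // -leqNgt -ltnS.
rewrite -zE (last_nth x); apply: segment_connect => //; first by rewrite leqnn andbT -ltnS.
by rewrite negb_and -ltnNge v_lt.
Qed.

Definition links X x y : bool := (x \in X) && connect (induced_rel e X) x y.

Definition minimal_link P x y : bool := minset (fun X => links X x y) P.

Section MinimalLink.
Variables (P : {set T}) (x y : T).
Hypothesis minP : minimal_link P x y.

Lemma minimal_link_cut v : v \in P -> v != x -> ~~ connect (induced_rel e (P :\ v)) x y.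
Proof.
move=> Pv neq_vx; have [/andP[Px _] min] := minsetP minP.
apply/negP => conPv; have := min _ _ (subsetDl P [set v]).
rewrite /links conPv !inE eq_sym neq_vx Px => /(_ isT)/setP/(_ v).
by rewrite !inE eqxx Pv.
Qed.

Lemma minimal_link_path :
  exists s, [/\ path e x s, last x s = y, uniq (x :: s) & P = [set z in x :: s]].
Proof.
have [/andP[Px /connectP[s0 ps0 ->]] min] := minsetP minP.
case/shortenP: ps0 min => s ps us _ min.
have sP := induced_path_sub ps Px.
have pes : path e x s by apply: sub_path ps => u v /and3P[].
exists s; split=> //; apply/esym/min; last by apply/subsetP => z; rewrite inE => /sP.
by rewrite /links inE mem_head path_induced_connect // => z sz; rewrite inE.
Qed.

(* A chord of the path would bypass one of its inner vertices. *)
Lemma minimal_link_bipartite : bipartite_on e P.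
Proof.
have [s [ps ls us PE]] := minimal_link_path; set p := x :: s in us PE.
have chordless u v : u \in p -> v \in p -> e u v -> index v p <= (index u p).+1.
  move=> pu pv euv; rewrite leqNgt; apply/negP => lt_uv.
  have lt_v : index v p <= size s by rewrite -ltnS index_mem.
  have lt_t : (index u p).+1 < size p := leq_trans lt_uv (leqW lt_v).
  pose t := nth x p (index u p).+1.
  have tE : index t p = (index u p).+1 by rewrite index_uniq.
  have Pt w : w \in p -> index w p != index t p -> w \in P :\ t.
    by rewrite PE in_setD1 inE => -> neq_wt; rewrite andbT; apply: contraNneq neq_wt => ->.
  have [] := negP (minimal_link_cut (v := t) _ _).
  - by rewrite PE inE mem_nth.
  - by apply: contra_eqN tE => /eqP->; rewrite /= eqxx.
  apply: (connect_trans (y := u)).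
    have := @segment_connect x s t 0 (index u p) ps us; rewrite -PE nth_index // tE ltnn.
    by apply=> //; apply: ltnW.
  apply: (connect_trans (y := v)).
    apply: connect1; apply/and3P; split=> //; apply: Pt => //; rewrite tE.
      by rewrite ltn_eqF.
    by rewrite gtn_eqF.
  rewrite -ls (last_nth x) -[v](nth_index x pv) PE; apply: segment_connect => //.
    by rewrite lt_v leqnn.
  by rewrite tE leqNgt lt_uv.
apply/existsP; exists [ffun z => odd (index z p)]; rewrite PE.
apply/forall_inP => u; rewrite inE => pu; apply/forall_inP => v; rewrite inE => pv.
apply/implyP => euv; rewrite !ffunE.
have := chordless u v pu pv euv; have := chordless v u pv pu; rewrite e_sym => /(_ euv).
have : index u p != index v p.
  apply: contraTneq euv => eq_uv.
  by rewrite -(nth_index x pu) -(nth_index x pv) eq_uv e_irr.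
by clear; lia.
Qed.

End MinimalLink.

Lemma minimal_link_exists D x y : x \in D -> connect (induced_rel e D) x y ->
  exists2 P : {set T}, P \subset D & minimal_link P x y.
Proof.
move=> Dx conD; have linkD : links D x y by rewrite /links Dx.
have [P minP sPD] := minset_exists (linkD : (fun X => links X x y) D).
by exists P.
Qed.

Lemma minimal_link_ends P x y : minimal_link P x y -> (x \in P) && (y \in P).
Proof.
move=> minP; have [s [_ <- _ ->]] := minimal_link_path minP.
by rewrite !inE -!in_cons mem_head mem_last.
Qed.

Lemma bypass_connect B x s i j (v := nth x (x :: s) i.+1) :
  path e x s -> uniq (x :: s) -> i < j < size s ->
  (forall y z, y \in B :\ v -> z \in B :\ v -> connect (induced_rel e (B :\ v)) y z) ->
  nth x (x :: s) i \in B -> nth x (x :: s) j.+1 \in B ->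
  connect (induced_rel e (([set z in x :: s] :|: B) :\ v)) x (last x s).
Proof.
move=> ps us /andP[lt_ij lt_js] conB Bi Bj; set p := x :: s in v conB us Bi Bj *.
have lt_i : i.+1 < size p := ltn_trans lt_ij lt_js.
have vE : index v p = i.+1 by rewrite index_uniq.
have neq_v k : k < size p -> k != i.+1 -> nth x p k != v.
  by move=> kp; apply: contraNneq => eq_kv; rewrite -vE -eq_kv index_uniq.
have sP : [set z in p] :\ v \subset ([set z in p] :|: B) :\ v by apply/setSD/subsetUl.
have sB : B :\ v \subset ([set z in p] :|: B) :\ v by apply/setSD/subsetUr.
apply: (connect_trans (y := nth x p i)).
  apply: (induced_connectS sP); apply: (@segment_connect x s v 0 i) => //; first exact: ltnW.
  by rewrite vE ltnn.
apply: (connect_trans (y := nth x p j.+1)).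
  apply: (induced_connectS sB); apply: conB; rewrite in_setD1 ?Bi ?Bj andbT neq_v //.
  - exact: ltnW.
  - by rewrite ltn_eqF.
  - by rewrite eqSS gtn_eqF.
rewrite (last_nth x); apply: (induced_connectS sP); apply: segment_connect => //.
  by rewrite lt_js leqnn.
by rewrite vE negb_and -ltnNge ltnS lt_ij.
Qed.

(** * Blocks *)

Lemma conn_nocut_connected B : conn_nocut e B -> induced_connected e B.
Proof. by case/andP. Qed.

Lemma conn_nocutP B v x y : conn_nocut e B -> x \in B :\ v -> y \in B :\ v ->
  connect (induced_rel e (B :\ v)) x y.
Proof.
case/andP=> conB /forallP/(_ v); rewrite /cut_vertex.
have [Bv /=|nBv _] := boolP (v \in B); last first.
  have -> : B :\ v = B by apply/setDidPl; rewrite disjoint_sym disjoints1.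
  exact: induced_connectedP.
move=> /exists_inPn nocut Bx By; have := nocut x Bx => /exists_inPn/(_ y By).
by rewrite negbK.
Qed.

Lemma connect_absorb X Y x y : Y \subset X ->
  (forall u v, u \in Y -> v \in Y -> connect (induced_rel e Y) u v) ->
  (forall z, z \in X -> exists2 c, c \in Y & connect (induced_rel e X) z c) ->
  x \in X -> y \in X -> connect (induced_rel e X) x y.
Proof.
move=> sYX conY absorb /absorb[c Yc xc] /absorb[d Yd yd].
apply: connect_trans xc _; rewrite induced_connect_sym; apply: connect_trans yd _.
exact/(induced_connectS sYX)/conY.
Qed.

Lemma conn_nocut_ear B b s : conn_nocut e B -> b \in B -> last b s \in B -> b != last b s ->
  path e b s -> uniq (b :: s) -> conn_nocut e (B :|: [set x in b :: s]).
Proof.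
move=> ncB Bb Bl neq_b ps us; set X := _ :|: _.
have sB : B \subset X := subsetUl _ _.
have ear_absorb v z : z \in X :\ v ->
    exists2 c, c \in B :\ v & connect (induced_rel e (X :\ v)) z c.
  rewrite 2!inE => /andP[zv /setUP[Bz|]]; first by exists z; rewrite ?inE ?zv.
  rewrite inE => sz; have [c [c_end cv zc]] := uniq_path_avoid ps us sz zv.
  exists c; last by apply: induced_connectS zc; apply/setSD/subsetUr.
  by rewrite in_setD1 cv; move: c_end; rewrite !inE => /orP[] /eqP->.
have conX v x y : x \in X :\ v -> y \in X :\ v -> connect (induced_rel e (X :\ v)) x y.
  apply: connect_absorb (ear_absorb v); first exact: setSD.
  by move=> u w; apply: conn_nocutP.
apply/andP; split; last first.
  apply/forallP => v; rewrite /cut_vertex negb_and; apply/orP; right.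
  by apply/exists_inPn => x Xx; apply/exists_inPn => y Xy; rewrite negbK conX.
apply/andP; split; first by apply/set0Pn; exists b; apply: (subsetP sB).
apply/forall_inP => x Xx; apply/forall_inP => y Xy; apply: (connect_absorb sB) Xx Xy.
  by move=> u v; apply/induced_connectedP/conn_nocut_connected.
move=> z Xz; have [->|neq_z] := eqVneq z b; first by exists b.
have [|c] := ear_absorb b z; first by rewrite in_setD1 neq_z.
by rewrite in_setD1 => /andP[_ Bc] zc; exists c => //; apply: induced_connectS zc; apply: subsetDl.
Qed.

Lemma is_blockP B : is_block e B ->
  conn_nocut e B /\ (forall B', B \subset B' -> conn_nocut e B' -> B' = B).
Proof.
case/andP=> ncB /forallP maxB; split=> // B' sB ncB'.
by apply/eqP; have := maxB B'; rewrite sB ncB'.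
Qed.

Lemma block_connected B : is_block e B -> induced_connected e B.
Proof. by case/is_blockP => /conn_nocut_connected. Qed.

Lemma block_nonempty B : is_block e B -> exists x, x \in B.
Proof. by move=> /block_connected/andP[/set0Pn]. Qed.

Definition off_block B : rel T := fun x y => e x y && ~~ ((x \in B) && (y \in B)).

Lemma off_block_sym B x y : connect (off_block B) x y = connect (off_block B) y x.
Proof.
by apply/sym_connect_sym => u v; rewrite /off_block e_sym [(u \in B) && _]andbC.
Qed.

(* A path outside B between two vertices of B would be an ear of B. *)
Lemma off_block_inj B b c :
  is_block e B -> b \in B -> c \in B -> connect (off_block B) b c -> b = c.
Proof.
move=> /is_blockP[ncB maxB] Bb Bc /connectP[s0 ps0 cE]; apply/eqP; apply: contraT => neq_bc.
move: Bc neq_bc; rewrite cE; case/shortenP: ps0 => s ps us _ Bl neq_b.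
have pes : path e b s by apply: sub_path ps => x y /andP[].
have /setP := maxB _ (subsetUl _ _) (conn_nocut_ear ncB Bb Bl neq_b pes us).
case: s ps neq_b {us pes Bl} => [|y s] /=; first by rewrite eqxx.
case/andP=> /andP[_ nBy] _ _ /(_ y); rewrite !inE eqxx !orbT => /esym By.
by rewrite Bb By in nBy.
Qed.

End Connections.

Section Gates.
Local Open Scope nat_scope.
Variables (T : finType) (e : rel T).
Hypotheses (e_sym : symmetric e) (e_irr : irreflexive e).
Hypothesis G_conn : forall x y : T, connect e x y.
Implicit Types (B D P Q S X Y Z : {set T}) (x y z c : T).

Definition contraction (rho : T -> T) : Prop :=
  forall x y, e x y -> rho x = rho y \/ e (rho x) (rho y).

Lemma contraction_connect rho Y Z x y : contraction rho -> (forall z, z \in Y -> rho z \in Z) ->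
  connect (induced_rel e Y) x y -> connect (induced_rel e Z) (rho x) (rho y).
Proof.
move=> rhoE rhoYZ /connectP[s + ->]; elim: s x => [|z s IHs] x //= /andP[/and3P[exz Yx Yz] /IHs].
apply: connect_trans; have [->|erz] := rhoE x z exz; first exact: connect0.
by apply: connect1; rewrite /induced_rel erz !rhoYZ.
Qed.

Lemma retract_connected D rho : D != set0 -> contraction rho ->
  (forall x, rho x \in D) -> {in D, forall x, rho x = x} -> induced_connected e D.
Proof.
move=> D0 rhoE rhoD rho_id; apply/andP; split=> //.
apply/forall_inP => x Dx; apply/forall_inP => y Dy; rewrite -(rho_id x Dx) -(rho_id y Dy).
apply: (@contraction_connect _ [set: T]) => //.
rewrite (@eq_connect _ _ e) => [//|u v]; by rewrite /induced_rel !inE !andbT.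
Qed.

(* The vertex of B at which x hangs off B, i.e. joined to x by edges outside B. *)
Definition gate B x : T := odflt x [pick b in B | connect (off_block e B) x b].

Definition fiber B c : {set T} := [set x | gate B x == c].

Definition collapse B c x : T := if x \in fiber B c then x else c.

Section OneBlock.
Variable B : {set T}.
Hypothesis blockB : is_block e B.

Lemma gateP x : gate B x \in B /\ connect (off_block e B) x (gate B x).
Proof.
rewrite /gate; case: pickP => [b /andP[] //|no_b]; exfalso.
have [b0 Bb0] := block_nonempty blockB; case/connectP: (G_conn x b0) => s ps b0E.
suff [b Bb xb] : exists2 b, b \in B & connect (off_block e B) x b.
  by have := no_b b; rewrite /= Bb xb.
elim: s x ps b0E {no_b} => [|y s IHs] x /=; first by move=> _ <-; exists b0.
case/andP=> exy ps b0E; have [b Bb yb] := IHs y ps b0E.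
have [Bx|nBx] := boolP (x \in B); first by exists x.
exists b => //; apply: connect_trans yb; apply: connect1.
by rewrite /off_block exy (negbTE nBx).
Qed.

Lemma gate_mem x : gate B x \in B. Proof. by have [] := gateP x. Qed.

Lemma gate_off_connect x y : connect (off_block e B) x y -> gate B x = gate B y.
Proof.
move=> xy; have [Bx cx] := gateP x; have [By cy] := gateP y.
apply: (off_block_inj e_sym blockB Bx By); apply: connect_trans (connect_trans xy cy).
by rewrite off_block_sym.
Qed.

Lemma gate_id x : x \in B -> gate B x = x.
Proof. by move=> Bx; have [Bg cg] := gateP x; apply/esym/(off_block_inj e_sym blockB). Qed.

Lemma gate_edge_neq x y : e x y -> gate B x != gate B y -> gate B x = x /\ gate B y = y.
Proof.
move=> exy neq_g; have [/andP[Bx By]|nB] := boolP ((x \in B) && (y \in B)).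
  by rewrite !gate_id.
by case/eqP: neq_g; apply/gate_off_connect/connect1; rewrite /off_block exy.
Qed.

Lemma fiber_gate c : c \in B -> c \in fiber B c.
Proof. by move=> Bc; rewrite inE gate_id. Qed.

Lemma fiberI c : c \in B -> fiber B c :&: B = [set c].
Proof.
move=> Bc; apply/setP => x; rewrite !inE.
by apply/andP/eqP => [[/eqP <- Bx]|->]; rewrite !gate_id ?eqxx.
Qed.

Lemma collapse_contraction c : contraction (collapse B c).
Proof.
move=> x y exy; have [eq_g|/(gate_edge_neq exy)[gx gy]] := eqVneq (gate B x) (gate B y).
  by rewrite /collapse !inE eq_g; case: ifP; [right | left].
by left; rewrite /collapse !inE gx gy; case: eqP => [->|_]; case: eqP => [->|_].
Qed.

Lemma collapse_fiber c x : c \in B -> collapse B c x \in fiber B c.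
Proof. by move=> Bc; rewrite /collapse; case: ifP => // _; apply: fiber_gate. Qed.

Lemma collapse_id c x : x \in fiber B c -> collapse B c x = x.
Proof. by rewrite /collapse => ->. Qed.

Lemma collapse_block c x : x \in B -> collapse B c x = c.
Proof. by move=> Bx; rewrite /collapse inE gate_id //; case: eqP. Qed.

Lemma fiber_connected c : c \in B -> induced_connected e (fiber B c).
Proof.
move=> Bc; apply: (@retract_connected _ (collapse B c)).
- by apply/set0Pn; exists c; apply: fiber_gate.
- exact: collapse_contraction.
- by move=> x; apply: collapse_fiber.
- by move=> x; apply: collapse_id.
Qed.

(* B2 has at most one vertex in B: a vertex z of B2 outside B remains connected to all of
   B2 when its gate is deleted. *)
Lemma gate_const B2 : is_block e B2 -> B != B2 -> {in B2 &, forall x y, gate B x = gate B y}.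
Proof.
move=> block2 neqB; have [nc2 max2] := is_blockP block2; have [ncB _] := is_blockP blockB.
have [z B2z nBz] : exists2 z, z \in B2 & z \notin B.
  by apply/subsetPn; apply: contra neqB => sB2; apply/eqP/max2.
have meet y : y \in B -> y \in B2 -> y = gate B z.
  move=> By B2y; apply/eqP; apply: contraT => neq_y.
  have conn_zy : connect (induced_rel e (B2 :\ gate B z)) z y.
    apply: conn_nocutP => //; rewrite in_setD1 ?neq_y // B2z andbT.
    by apply: contraNneq nBz => ->; apply: gate_mem.
  have fiber_closed : closed (induced_rel e (B2 :\ gate B z)) (fiber B (gate B z)).
    move=> a b /and3P[eab]; rewrite !in_setD1 => /andP[neq_a _] /andP[neq_b _]; rewrite !inE.
    have [->//|/(gate_edge_neq eab)[-> ->]] := eqVneq (gate B a) (gate B b).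
    by rewrite (negbTE neq_a) (negbTE neq_b).
  by have := closed_connect fiber_closed conn_zy; rewrite !inE eqxx gate_id // (negbTE neq_y).
move=> x y B2x B2y; apply: gate_off_connect.
have := induced_connectedP (conn_nocut_connected nc2) B2x B2y; apply: connect_sub.
move=> a b /and3P[eab B2a B2b]; apply: connect1; rewrite /off_block eab /=.
by apply/negP => /andP[Ba Bb]; move: eab; rewrite (meet a) // -(meet b) // e_irr.
Qed.

End OneBlock.

Lemma block_gates B1 B2 : is_block e B1 -> is_block e B2 -> B1 != B2 ->
  exists c1 c2, {in B2, forall x, gate B1 x = c1} /\ {in B1, forall x, gate B2 x = c2}.
Proof.
move=> bl1 bl2 neq12; have [x1 Bx1] := block_nonempty bl1; have [x2 Bx2] := block_nonempty bl2.
exists (gate B1 x2), (gate B2 x1); split=> x Bx; first exact: gate_const Bx2.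
by apply: (gate_const bl2 bl1) => //; rewrite eq_sym.
Qed.

Section TwoBlocks.
Variables (B1 B2 : {set T}) (c1 c2 : T).
Hypotheses (block1 : is_block e B1) (block2 : is_block e B2).
Hypotheses (gate1 : {in B2, forall x, gate B1 x = c1}) (gate2 : {in B1, forall x, gate B2 x = c2}).

Definition between : {set T} := fiber B1 c1 :&: fiber B2 c2.

Lemma between_gates_mem : c1 \in B1 /\ c2 \in B2.
Proof.
have [x1 Bx1] := block_nonempty block1; have [x2 Bx2] := block_nonempty block2.
by rewrite -(gate1 Bx2) -(gate2 Bx1) !gate_mem.
Qed.

Lemma between_gates : c1 \in between /\ c2 \in between.
Proof.
have [Bc1 Bc2] := between_gates_mem.
by rewrite !inE (gate2 Bc1) (gate1 Bc2) !gate_id // !eqxx.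
Qed.

Definition between_retraction x : T := collapse B2 c2 (collapse B1 c1 x).

Lemma between_retraction_contraction : contraction between_retraction.
Proof.
move=> x y /(collapse_contraction block1 c1); rewrite /between_retraction.
by case=> [->|/(collapse_contraction block2 c2)]; first left.
Qed.

Lemma between_retraction_mem x : between_retraction x \in between.
Proof.
have [Bc1 Bc2] := between_gates_mem; have [_ Dc2] := between_gates.
rewrite /between_retraction {1}/collapse; case: ifP => [x2|//].
by rewrite inE x2 collapse_fiber.
Qed.

Lemma between_retraction_id : {in between, forall x, between_retraction x = x}.
Proof. by move=> x /setIP[x1 x2]; rewrite /between_retraction !collapse_id. Qed.

Lemma between_retraction_left x : x \in B1 -> between_retraction x = c1.
Proof.
move=> B1x; have [/setIP[_ c1_2] _] := between_gates.
by rewrite /between_retraction (collapse_block block1) // collapse_id.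
Qed.

Lemma between_retraction_right x : x \in B2 -> between_retraction x = c2.
Proof.
move=> B2x; have B1x : x \in fiber B1 c1 by rewrite inE gate1.
by rewrite /between_retraction (collapse_id B1x) collapse_block.
Qed.

Lemma between_connected : induced_connected e between.
Proof.
have [Dc1 _] := between_gates; apply: (@retract_connected _ between_retraction).
- by apply/set0Pn; exists c1.
- exact: between_retraction_contraction.
- exact: between_retraction_mem.
- exact: between_retraction_id.
Qed.

Lemma between_left : B1 :&: between = [set c1].
Proof.
have [Bc1 _] := between_gates_mem; have [/setIP[_ c1_2] _] := between_gates.
by rewrite setIA [B1 :&: _]setIC fiberI //; apply/setIidPl; rewrite sub1set.
Qed.

Lemma between_right : B2 :&: between = [set c2].
Proof.
have [_ Bc2] := between_gates_mem; have [_ /setIP[c2_1 _]] := between_gates.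
by rewrite setICA [B2 :&: _]setIC fiberI //; apply/setIidPr; rewrite sub1set.
Qed.

Lemma blocks_meet_between : B1 :&: B2 \subset between.
Proof. by apply/subsetP => x /setIP[B1x B2x]; rewrite !inE gate1 // gate2 // !eqxx. Qed.

Lemma between_separated x y :
  x \in B1 -> x != c1 -> y \in between -> y != c1 -> ~~ e x y.
Proof.
move=> B1x neq_x; rewrite 2!inE => /andP[/eqP gy _] neq_y; apply/negP => exy.
have [|_] := gate_edge_neq block1 exy; first by rewrite gate_id // gy.
by rewrite gy => eq_y; rewrite eq_y eqxx in neq_y.
Qed.

End TwoBlocks.

Lemma complete_intersection_F2_distributive (K : fieldType) :
  complete_intersection e K -> ~~ bipartite_on e [set: T] -> F2_distributive e.
Proof.
move=> G_ci nbT; apply: complete_intersection_distributive G_ci _ => x.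
have conT : induced_connected e [set: T].
  by apply: (@retract_connected _ id) => //; [apply/set0Pn; exists x | right].
by have [|w [_ wx]] := odd_closed_exists e_sym e_irr conT nbT (_ : x \in _); [| exists w].
Qed.

Hypothesis distributive : F2_distributive e.

Lemma nonbipartite_attached_contradiction D S1 S2 c1 c2 :
  induced_connected e D -> induced_connected e S1 -> induced_connected e S2 ->
  ~~ bipartite_on e D -> ~~ bipartite_on e S1 -> ~~ bipartite_on e S2 ->
  S1 :&: D = [set c1] -> S2 :&: D = [set c2] -> S1 :&: S2 \subset D ->
  (forall x y, x \in S1 -> x != c1 -> y \in D -> y != c1 -> ~~ e x y) -> False.
Proof.
move=> conD conS1 conS2 nbD nbS1 nbS2 S1D S2D S12 cross.
have mem_meet S c : S :&: D = [set c] -> c \in S /\ c \in D.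
  by move/setP/(_ c); rewrite !inE eqxx => /andP.
have [S1c1 Dc1] := mem_meet _ _ S1D; have [S2c2 Dc2] := mem_meet _ _ S2D.
have [P sPD minP] := minimal_link_exists Dc1 (induced_connectedP conD Dc1 Dc2).
have /andP[Pc1 Pc2] := minimal_link_ends minP.
have conP : connect (induced_rel e P) c1 c2 by have [/andP[]] := minsetP minP.
have [r oddD] := odd_closed_exists e_sym e_irr conD nbD Dc1.
have [q1 odd1] := odd_closed_exists e_sym e_irr conS1 nbS1 S1c1.
have [q2 odd2] := odd_closed_exists e_sym e_irr conS2 nbS2 S2c2.
apply: (odd_sets_attached_contradiction e_sym e_irr distributive sPD
  (minimal_link_bipartite e_sym e_irr minP) Pc1 Pc2 conP S1D S2D _ cross oddD odd1 odd2).
apply/subsetP => x S12x; suff : x \in S1 :&: D by rewrite S1D => /set1P ->.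
by rewrite inE (subsetP S12) // andbT; case/setIP: S12x.
Qed.

Definition nonbipartite_block B : bool := is_block e B && ~~ bipartite_on e B.

Lemma bipartite_onS X Y : X \subset Y -> bipartite_on e Y -> bipartite_on e X.
Proof.
move=> /subsetP sXY /existsP[chi /forall_inP chiP]; apply/existsP; exists chi.
apply/forall_inP => x /sXY Yx; apply/forall_inP => y /sXY Yy.
exact: (forall_inP (chiP x Yx)).
Qed.

(* If the gates c' and c'' differed, then the fibers over them would be odd sets attached to
   the odd set B. *)
Lemma nonbipartite_gate_eq B B' B'' x' x'' :
  nonbipartite_block B -> nonbipartite_block B' -> nonbipartite_block B'' ->
  B != B' -> B != B'' -> x' \in B' -> x'' \in B'' -> gate B x' = gate B x''.
Proof.
move=> /andP[bl nb] /andP[bl' nb'] /andP[bl'' nb''] neq' neq'' Bx' Bx''.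
have nb_fiber B0 x : is_block e B0 -> ~~ bipartite_on e B0 -> B != B0 -> x \in B0 ->
    ~~ bipartite_on e (fiber B (gate B x)).
  move=> bl0 nb0 neq0 B0x; apply: contra nb0; apply: bipartite_onS.
  by apply/subsetP => y B0y; rewrite inE (gate_const bl bl0 neq0 B0y B0x).
apply/eqP; apply: contraT => neq_gate.
case: (@nonbipartite_attached_contradiction B (fiber B (gate B x')) (fiber B (gate B x''))
    (gate B x') (gate B x'')); rewrite ?fiberI ?gate_mem //.
- exact: block_connected.
- by apply: fiber_connected => //; apply: gate_mem.
- by apply: fiber_connected => //; apply: gate_mem.
- exact: nb_fiber Bx'.
- exact: nb_fiber Bx''.
- apply/subsetP => y; rewrite !inE => /andP[/eqP y' /eqP y''].
  by rewrite -y' -y'' eqxx in neq_gate.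
- move=> x y; rewrite inE => /eqP gx neq_x By neq_y; apply/negP => exy.
  have [|gxx _] := gate_edge_neq bl exy; first by rewrite gx (gate_id bl By) eq_sym.
  by rewrite -gx gxx eqxx in neq_x.
Qed.

Lemma no_three_nonbipartite_blocks B1 B2 B3 :
  nonbipartite_block B1 -> nonbipartite_block B2 -> nonbipartite_block B3 ->
  B1 != B2 -> B1 != B3 -> B2 = B3.
Proof.
move=> nbl1 nbl2 nbl3 neq12 neq13; apply/eqP; apply: contraT => neq23.
have [/andP[bl1 nb1] /andP[bl2 nb2] /andP[bl3 nb3]] := And3 nbl1 nbl2 nbl3.
have neq21 : B2 != B1 by rewrite eq_sym.
have [x1 Bx1] := block_nonempty bl1; have [x2 Bx2] := block_nonempty bl2.
have [c1 [c2 [gate1 gate2]]] := block_gates bl1 bl2 neq12.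
case: (nonbipartite_attached_contradiction (between_connected bl1 bl2 gate1 gate2)
  (block_connected bl1) (block_connected bl2) _ nb1 nb2 (between_left bl1 bl2 gate1 gate2)
  (between_right bl1 bl2 gate1 gate2) (blocks_meet_between gate1 gate2)).
- apply: contra nb3; apply: bipartite_onS; apply/subsetP => x Bx; rewrite !inE.
  rewrite (nonbipartite_gate_eq nbl1 nbl3 nbl2 neq13 neq12 Bx Bx2) gate1 // eqxx.
  by rewrite (nonbipartite_gate_eq nbl2 nbl3 nbl1 neq23 neq21 Bx Bx1) gate2 // eqxx.
- by move=> x y; apply: (between_separated bl1).
Qed.

(* By [common_connection], c1 and c2 are still connected in what Q has in common with P, B1
   and B2; this retracts onto P, and onto P minus v if Q avoids v, against minimality. *)
Lemma minimal_link_sub B1 B2 c1 c2 P Q :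
  nonbipartite_block B1 -> nonbipartite_block B2 ->
  {in B2, forall x, gate B1 x = c1} -> {in B1, forall x, gate B2 x = c2} ->
  P \subset between B1 B2 c1 c2 -> minimal_link e P c1 c2 -> links e Q c1 c2 -> P \subset Q.
Proof.
move=> /andP[bl1 nb1] /andP[bl2 nb2] gate1 gate2 sPD minP /andP[Qc1 conQ].
have [Bc1 Bc2] := between_gates_mem bl1 bl2 gate1 gate2.
have Qc2 : c2 \in Q.
  by have [P' /subsetP sP'Q /minimal_link_ends/andP[_ /sP'Q]] := minimal_link_exists Qc1 conQ.
have [q1 odd1] := odd_closed_exists e_sym e_irr (block_connected bl1) nb1 Bc1.
have [q2 odd2] := odd_closed_exists e_sym e_irr (block_connected bl2) nb2 Bc2.
have [/andP[_ conP] _] := minsetP minP; have /andP[Pc1 Pc2] := minimal_link_ends minP.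
have conPQ := common_connection e_sym e_irr distributive (block_connected bl1)
  (block_connected bl2) Bc1 Bc2 odd1 odd2 conP conQ.
apply/subsetP => v Pv; apply: contraT => nQv; have nvQ z : z \in Q -> z != v.
  by move=> Qz; apply: contraNneq nQv => <-.
have := minimal_link_cut minP Pv; rewrite eq_sym nvQ // => /(_ isT)/negP[].
have rho_c1 := between_retraction_left bl1 bl2 gate1 gate2 Bc1.
have rho_c2 := between_retraction_right c2 bl2 gate1 Bc2.
rewrite -rho_c1 -[X in connect _ _ X]rho_c2.
apply: contraction_connect (between_retraction_contraction c1 c2 bl1 bl2) _ conPQ => z.
case/setIP=> z_P z_Q; rewrite in_setD1.
have [B1z|nB1z] := boolP (z \in B1).
  by rewrite (between_retraction_left bl1 bl2 gate1 gate2) // nvQ.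
have [B2z|nB2z] := boolP (z \in B2).
  by rewrite (between_retraction_right c2 bl2 gate1) // nvQ.
move: z_P z_Q; rewrite !inE (negbTE nB1z) (negbTE nB2z) !orbF /= => Pz Qz.
by rewrite between_retraction_id ?(subsetP sPD) // nvQ.
Qed.

(* A block with two edges on the path P would bypass a vertex of P. *)
Lemma nonbipartite_blocks_contiguous B1 B2 :
  nonbipartite_block B1 -> nonbipartite_block B2 -> B1 != B2 -> contiguous e B1 B2.
Proof.
move=> nbl1 nbl2 neq12; have [/andP[bl1 _] /andP[bl2 _]] := (nbl1, nbl2).
have [c1 [c2 [gate1 gate2]]] := block_gates bl1 bl2 neq12.
have [Bc1 Bc2] := between_gates_mem bl1 bl2 gate1 gate2.
have [Dc1 Dc2] := between_gates bl1 bl2 gate1 gate2.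
have conD := induced_connectedP (between_connected bl1 bl2 gate1 gate2) Dc1 Dc2.
have [P sPD minP] := minimal_link_exists Dc1 conD.
have [s [ps ls us PE]] := minimal_link_path minP.
suff one_edge B i j : is_block e B -> i < j < size s ->
    nth c1 (c1 :: s) i \in B -> nth c1 (c1 :: s) j.+1 \in B -> False.
  exists c1, s; split; rewrite ?ls // => i j lt_i lt_j neq_ij B blB.
  apply/negP => /andP[/and3P[_ Bi Bi1] /and3P[_ Bj Bj1]].
  have [lt_ij|lt_ji|eq_ij] := ltngtP i j; last by rewrite eq_ij eqxx in neq_ij.
    by apply: (one_edge B i j) => //; rewrite lt_ij.
  by apply: (one_edge B j i) => //; rewrite lt_ji.
move=> blB ij Bi Bj; set v := nth c1 (c1 :: s) i.+1.
have [/andP[lt_ij lt_j] [ncB _]] := (ij, is_blockP blB).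
have conQ := bypass_connect ps us ij (fun y z => conn_nocutP ncB) Bi Bj.
have lt_i : i.+1 < size (c1 :: s) := ltn_trans lt_ij lt_j.
have Pv : v \in P by rewrite PE inE mem_nth.
suff /subsetP/(_ v Pv) : P \subset ([set z in c1 :: s] :|: B) :\ v by rewrite !inE eqxx.
apply: (minimal_link_sub nbl1 nbl2 gate1 gate2 sPD minP).
rewrite /links -ls conQ andbT in_setD1 !inE eqxx andbT.
apply/negP => /eqP vE; have : index v (c1 :: s) = i.+1 by rewrite index_uniq.
by rewrite -vE /= eqxx.
Qed.

End Gates.

Theorem theorem4p2 (K : fieldType) (T : finType) (e : rel T)
  (e_sym : symmetric e) (e_irr : irreflexive e)
  (G_conn : forall x y : T, connect e x y)
  (G_ci : complete_intersection e K) :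
  let NB := nonbip_blocks e in
  (* exactly one of (1), (2), (3): they are mutually exclusive by counting *)
  [/\ (#|NB| = 0%N) \/ (#|NB| = 1%N) \/
      (exists B1 B2 : {set T}, [/\ NB = [set B1; B2], B1 != B2 & contiguous e B1 B2]),
      ~ ((#|NB| = 0%N) /\ (#|NB| = 1%N)),
      ~ ((#|NB| = 0%N) /\ (exists B1 B2 : {set T}, [/\ NB = [set B1; B2], B1 != B2 & contiguous e B1 B2]))
    & ~ ((#|NB| = 1%N) /\ (exists B1 B2 : {set T}, [/\ NB = [set B1; B2], B1 != B2 & contiguous e B1 B2]))].
Proof.
move=> NB; have NBE B : (B \in NB) = nonbipartite_block e B by rewrite inE.
split; last 3 first.
- by case=> ->.
- by case=> NB0 [B1 [B2 [eqNB neqB _]]]; move: NB0; rewrite eqNB cards2 neqB.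
- by case=> NB1 [B1 [B2 [eqNB neqB _]]]; move: NB1; rewrite eqNB cards2 neqB.
have [|/card_gt1P[B1 [B2 [nbl1 nbl2 neq12]]]] := leqP #|NB| 1.
  by case: #|NB| => [|[|]] //; auto.
rewrite !NBE in nbl1 nbl2; right; right; exists B1, B2.
have distr : F2_distributive e.
  apply: (complete_intersection_F2_distributive e_sym e_irr G_conn G_ci).
  by case/andP: nbl1 => _; apply/contra/bipartite_onS/subsetT.
split=> //; last exact: (nonbipartite_blocks_contiguous e_sym e_irr G_conn distr).
apply/setP => B3; rewrite NBE !inE; apply/idP/orP => [nbl3|[] /eqP -> //].
have [_|neq13] := eqVneq B1 B3; first by left.
by right; apply/eqP/esym/(no_three_nonbipartite_blocks e_sym e_irr G_conn distr nbl1 nbl2 nbl3).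
Qed.
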